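(* Let $T\ge 1$, $\rho>0$, and let $\mathbf{s}=(s_0,\dots,s_{T-1})^T\in\mathbb{C}^T$ be given, with $\mathbf{D}_{\mathbf{s}}=\operatorname{diag}(s_0,\dots,s_{T-1})$. Let $\mathbf{y}=\sqrt{\rho}\,\mathbf{D}_{\mathbf{s}}\,\mathbf{h}\,e^{j\Theta}+\mathbf{w}$, where $\mathbf{h}\sim\mathcal{CN}(\boldsymbol{\mu}_{\mathbf{h}},\boldsymbol{\Lambda}_{\mathbf{h}})$ with $\boldsymbol{\mu}_{\mathbf{h}}\in\mathbb{C}^T$ and real positive semidefinite covariance $\boldsymbol{\Lambda}_{\mathbf{h}}\in\mathbb{R}^{T\times T}$, $\mathbf{w}\sim\mathcal{CN}(\mathbf{0},\mathbf{I}_T)$, $\Theta$ is uniformly distributed on $(-\pi,\pi]$, and $\mathbf{h},\mathbf{w},\Theta$ are mutually independent. Then the probability density of $\mathbf{y}$ given $\mathbf{s}$ is $$p(\mathbf{y}\mid\mathbf{s})=\frac{1}{\pi^{T}\det(\boldsymbol{\Lambda}_{\mathbf{y}|\mathbf{s}})}\,\exp\!\Big(-\mathbf{y}^\dagger\boldsymbol{\Lambda}_{\mathbf{y}|\mathbf{s}}^{-1}\mathbf{y}-\rho\,\boldsymbol{\mu}_{\mathbf{h}}^\dagger\mathbf{D}_{\mathbf{s}}^\dagger\boldsymbol{\Lambda}_{\mathbf{y}|\mathbf{s}}^{-1}\mathbf{D}_{\mathbf{s}}\boldsymbol{\mu}_{\mathbf{h}}\Big)\, I_0\!\Big(2\sqrt{\rho}\,\big|\mathbf{y}^\dagger\boldsymbol{\Lambda}_{\mathbf{y}|\mathbf{s}}^{-1}\mathbf{D}_{\mathbf{s}}\boldsymbol{\mu}_{\mathbf{h}}\big|\Big),$$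 where $\boldsymbol{\Lambda}_{\mathbf{y}|\mathbf{s}}=\rho\,\mathbf{D}_{\mathbf{s}}\boldsymbol{\Lambda}_{\mathbf{h}}\mathbf{D}_{\mathbf{s}}^\dagger+\mathbf{I}_T$.
   Context: $\dagger$ denotes conjugate transpose, $j=\sqrt{-1}$. $\mathcal{CN}(\boldsymbol{\mu},\boldsymbol{\Lambda})$ is the circularly symmetric complex Gaussian distribution with mean $\boldsymbol{\mu}$ and covariance $\boldsymbol{\Lambda}=\mathrm{E}[(\mathbf{x}-\boldsymbol{\mu})(\mathbf{x}-\boldsymbol{\mu})^\dagger]$ (possibly degenerate; for instance $\boldsymbol{\Lambda}=\mathbf{0}$ means $\mathbf{x}=\boldsymbol{\mu}$ is deterministic); $\mathcal{CN}(\mathbf{0},\mathbf{I}_T)$ has density $\pi^{-T}e^{-\|\mathbf{x}\|^2}$ on $\mathbb{C}^T$. $I_0(z)=\frac1\pi\int_0^\pi e^{z\cos\eta}\,d\eta$ is the zeroth order modified Bessel function of the first kind. *)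

(* Defs.v *)
From HB Require Import structures.
From mathcomp Require Import all_boot all_order all_algebra.
From mathcomp Require Import all_classical all_reals all_analysis.
From mathcomp Require Import complex.
Set Implicit Arguments.
Unset Strict Implicit.
Unset Printing Implicit Defensive.
Import Order.TTheory GRing.Theory Num.Theory.
Import numFieldNormedType.Exports.
Local Open Scope ring_scope.
Local Open Scope classical_set_scope.
Local Open Scope sesquilinear_scope.
Local Open Scope complex_scope.

(* The Borel sigma-algebra of C, identified with R * R, and the product
   sigma-algebra on matrices (generated by the entries); in particular
   'cV[R[i]]_n carries the Borel sigma-algebra of C^n. *)
HB.instance Definition _ (R : realType) := isPointed.Build R[i] (0 : R[i]).

Section measurable_complex.
Variable R : realType.
Let G := g_sigma_preimageU (@complex.Re R) (@complex.Im R).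
Let G0 : G set0. Proof. exact: sigma_algebra0. Qed.
Let GC A : G A -> G (~` A). Proof. exact: sigma_algebraC. Qed.
Let GU (F : (set R[i])^nat) : (forall i, G (F i)) -> G (\bigcup_i F i).
Proof. exact: sigma_algebra_bigcup. Qed.
HB.instance Definition _ :=
  @isMeasurable.Build default_measure_display R[i] G G0 GC GU.
End measurable_complex.

Section measurable_matrix.
Context d (T : measurableType d) (m n : nat).
Let G := <<s [set A : set 'M[T]_(m, n) |
  exists i j (B : set T), measurable B /\ A = [set M | B (M i j)]] >>.
Let G0 : G set0. Proof. exact: sigma_algebra0. Qed.
Let GC A : G A -> G (~` A). Proof. exact: sigma_algebraC. Qed.
Let GU (F : (set 'M[T]_(m, n))^nat) : (forall i, G (F i)) -> G (\bigcup_i F i).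
Proof. exact: sigma_algebra_bigcup. Qed.
HB.instance Definition _ :=
  @isMeasurable.Build (measure_tuple_display d) 'M[T]_(m, n) G G0 GC GU.
End measurable_matrix.

Lemma measurable_entry d (T : measurableType d) m n (i : 'I_m) (j : 'I_n) :
  measurable_fun [set: 'M[T]_(m, n)] (fun M : 'M[T]_(m, n) => M i j).
Proof.
move=> _ B mB; rewrite setTI; apply: sub_sigma_algebra.
by exists i, j, B.
Qed.

Lemma measurable_fun_mx d1 d2 (T1 : measurableType d1) (T2 : measurableType d2)
    m n (f : T1 -> 'M[T2]_(m, n)) :
  (forall i j, measurable_fun [set: T1] (fun x => f x i j)) ->
  measurable_fun [set: T1] f.
Proof.
move=> mf; apply: (@measurability _ _ _ _ _ f
  [set A : set 'M[T2]_(m, n) |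
  exists i j (B : set T2), measurable B /\ A = [set M | B (M i j)]]) => //.
move=> _ [_ [i [j [B [mB ->]]]] <-].
exact: mf.
Qed.

Section complex_measurable_fun.
Variable R : realType.

Lemma measurable_Re : measurable_fun [set: R[i]] (@complex.Re R).
Proof.
by move=> _ B mB; rewrite setTI; apply: sub_sigma_algebra; left; exists B => //;
  rewrite setTI.
Qed.

Lemma measurable_Im : measurable_fun [set: R[i]] (@complex.Im R).
Proof.
by move=> _ B mB; rewrite setTI; apply: sub_sigma_algebra; right; exists B => //;
  rewrite setTI.
Qed.

Definition complex_of_pair (p : measurableTypeR R * measurableTypeR R) : R[i] :=
  p.1 +i* p.2.

Lemma measurable_complex_of_pair : measurable_fun setT complex_of_pair.
Proof.
apply: (@measurability _ _ _ _ _ complex_of_pair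
  (preimage_set_system setT (@complex.Re R) measurable `|`
   preimage_set_system setT (@complex.Im R) measurable)) => //.
move=> _ [_ [[B mB <-]|[B mB <-]] <-]; rewrite !setTI.
  have /= := @measurable_fst _ _ (measurableTypeR R) (measurableTypeR R) measurableT B mB.
  by rewrite setTI.
have /= := @measurable_snd _ _ (measurableTypeR R) (measurableTypeR R) measurableT B mB.
by rewrite setTI.
Qed.

End complex_measurable_fun.

Lemma sigma_finite_product d1 d2 (T1 : measurableType d1)
    (T2 : measurableType d2) (R : realType)
    (m1 : {sigma_finite_measure set T1 -> \bar R})
    (m2 : {sigma_finite_measure set T2 -> \bar R}) :
  sigma_finite setT (m1 \x m2)%E.
Proof.
have /sigma_finiteP[F [TF ndF Foo]] := sigma_finiteT m1.
have /sigma_finiteP[G [TG ndG Goo]] := sigma_finiteT m2.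
exists (fun n => F n `*` G n).
  rewrite -setXTT TF TG predeqE => -[x y]; split.
    move=> [/= [n _ Fnx] [k _ Gky]]; exists (maxn n k) => //; split.
    - by move: x Fnx; exact/subsetPset/ndF/leq_maxl.
    - by move: y Gky; exact/subsetPset/ndG/leq_maxr.
  by move=> [n _ []/= ? ?]; split; exists n.
move=> k; have [? ?] := Foo k; have [? ?] := Goo k.
split; first exact: measurableX.
by rewrite product_measure1E// lte_mul_pinfty// ge0_fin_numE.
Qed.

Lemma sigma_finite_pushforward d1 d2 (T1 : measurableType d1)
    (T2 : measurableType d2) (R : realType) (m : set T1 -> \bar R)
    (f : T1 -> T2) (g : T2 -> T1) :
  measurable_fun setT g -> cancel f g -> sigma_finite setT m ->
  sigma_finite setT (pushforward m f).
Proof.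
move=> mg fK [F FT Foo]; exists (fun k => g @^-1` F k).
  by rewrite -preimage_bigcup -FT preimage_setT.
move=> k; have [mF Fk] := Foo k; split.
  by rewrite -[X in measurable X]setTI; exact: mg.
rewrite /pushforward -comp_preimage.
by rewrite (_ : g \o f = id) ?preimage_id//; apply/funext => x /=.
Qed.

(* Lebesgue measure on C, then on C^n by iterated products: C^n.+1 is C * C^n,
   and C^0 is a point of mass 1.  lebesgue_cV_box characterizes the result. *)
Section lebesgue_complex.
Variable R : realType.

Definition lebesgue_complex : set R[i] -> \bar R :=
  pushforward (lebesgue_measure \x lebesgue_measure)%E (@complex_of_pair R).

Let M : {measure set R[i] -> \bar R} :=
  measure_function_pushforward__canonical__measure_function_Measure
   (lebesgue_measure \x lebesgue_measure)%E (@measurable_complex_of_pair R).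

HB.instance Definition _ := isMeasure.Build _ _ _ lebesgue_complex
  (measure0 M) (measure_ge0 M) (@measure_semi_sigma_additive _ _ _ M).

Let sigma_finite_lebesgue_complex : sigma_finite setT lebesgue_complex.
Proof.
apply: (@sigma_finite_pushforward _ _ _ _ _ _
   (@complex_of_pair R) (fun z : R[i] =>
     (complex.Re z, complex.Im z) : measurableTypeR R * measurableTypeR R)).
  by apply/measurable_fun_pair; [exact: measurable_Re|exact: measurable_Im].
  by case.
exact: sigma_finite_product.
Qed.

HB.instance Definition _ := Measure_isSigmaFinite.Build _ _ _ lebesgue_complex
  sigma_finite_lebesgue_complex.

End lebesgue_complex.

Section lebesgue_cV.
Variable R : realType.

Definition cV_cons n (p : R[i] * 'cV[R[i]]_n) : 'cV[R[i]]_n.+1 :=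
  col_mx (const_mx p.1 : 'cV_1) p.2.

Lemma measurable_cV_cons n : measurable_fun setT (@cV_cons n).
Proof.
apply: measurable_fun_mx => i j.
rewrite /cV_cons; under eq_fun do rewrite mxE.
case: split_ordP => k _.
  by under eq_fun do rewrite mxE; exact: measurable_fst.
by apply: measurableT_comp (measurable_entry _ _) _.
Qed.

Lemma cV_cons0 n (p : R[i] * 'cV[R[i]]_n) : cV_cons p ord0 0 = p.1.
Proof.
have -> : ord0 = lshift n (ord0 : 'I_1) :> 'I_n.+1 by exact: val_inj.
by rewrite [LHS](col_mxEu (const_mx p.1 : 'cV_1) p.2) mxE.
Qed.

Lemma cV_consS n (p : R[i] * 'cV[R[i]]_n) i :
  cV_cons p (lift ord0 i) 0 = p.2 i 0.
Proof.
have -> : lift ord0 i = rshift 1 i :> 'I_n.+1 by exact: val_inj.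
exact: (col_mxEd (const_mx p.1 : 'cV_1) p.2).
Qed.

Section cons_measure.
Variables (n : nat) (m : {sigma_finite_measure set 'cV[R[i]]_n -> \bar R}).

Definition cons_measure : set 'cV[R[i]]_n.+1 -> \bar R :=
  pushforward (@lebesgue_complex R \x m)%E (@cV_cons n).

Let M : {measure set 'cV[R[i]]_n.+1 -> \bar R} :=
  measure_function_pushforward__canonical__measure_function_Measure
   (@lebesgue_complex R \x m)%E (@measurable_cV_cons n).

HB.instance Definition _ := isMeasure.Build _ _ _ cons_measure
  (measure0 M) (measure_ge0 M) (@measure_semi_sigma_additive _ _ _ M).

Let sigma_finite_cons_measure : sigma_finite setT cons_measure.
Proof.
apply: (@sigma_finite_pushforward _ _ _ _ _ _
   (@cV_cons n) (fun v : 'cV[R[i]]_(1 + n) => (v ord0 ord0, dsubmx v))).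
  apply/measurable_fun_pair; first exact: measurable_entry.
  apply: measurable_fun_mx => i j; under eq_fun do rewrite mxE.
  exact: measurable_entry.
  move=> [z v]; congr pair; last by rewrite /cV_cons /= col_mxKd.
  exact: cV_cons0.
exact: sigma_finite_product.
Qed.

HB.instance Definition _ := Measure_isSigmaFinite.Build _ _ _ cons_measure
  sigma_finite_cons_measure.

End cons_measure.

Fixpoint lebesgue_cV n : {sigma_finite_measure set 'cV[R[i]]_n -> \bar R} :=
  if n is k.+1 then cons_measure (lebesgue_cV k) else \d_(0 : 'cV[R[i]]_0).

Lemma lebesgue_cV_box n (B : 'I_n -> set R[i]) :
  (forall i, measurable (B i)) ->
  lebesgue_cV n [set v | forall i, B i (v i 0)] =
  (\prod_(i < n) lebesgue_complex (B i))%E.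
Proof.
elim: n B => [|n IH] B mB.
  rewrite big_ord0 /= diracE mem_set//= => -[]//.
rewrite big_ord_recl -(IH (fun i => B (lift ord0 i)))//.
rewrite [LHS]/= /cons_measure /pushforward.
have mC : measurable [set v : 'cV[R[i]]_n | forall i, B (lift ord0 i) (v i 0)].
  rewrite (_ : [set _ | _] =
      \bigcap_(i in setT) [set v : 'cV[R[i]]_n | B (lift ord0 i) (v i 0)]).
    apply: fin_bigcap_measurable => // i _.
    rewrite -[X in measurable X]setTI.
    exact: (measurable_entry _ _ measurableT (mB (lift ord0 i))).
  by apply/seteqP; split => v /= H i; [move=> _|]; exact: H.
rewrite -product_measure1E//.
congr ((_ \x _)%E _); apply/seteqP; split => -[z v] /=.
  move=> H; split => [|i]; first by have := H ord0; rewrite cV_cons0.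
  by have := H (lift ord0 i); rewrite cV_consS.
move=> [Hz Hv] i; case: (unliftP ord0 i) => [j|] ->.
  by rewrite cV_consS; exact: Hv.
by rewrite cV_cons0.
Qed.

End lebesgue_cV.

Section complex_random_vectors.
Context (R : realType) (d : measure_display) (Omega : measurableType d)
  (P : probability Omega R).

Definition has_density n (X : Omega -> 'cV[R[i]]_n) (p : 'cV[R[i]]_n -> R) :=
  [/\ measurable_fun [set: Omega] X,
      measurable_fun [set: 'cV[R[i]]_n] p,
      forall v, 0 <= p v &
      forall B : set 'cV[R[i]]_n, measurable B ->
        P (X @^-1` B) = (\int[lebesgue_cV R n]_(v in B) (p v)%:E)%E].

(* The density of CN(0, I_n); normc is the modulus, with values in R. *)
Definition std_cgauss_pdf n (z : 'cV[R[i]]_n) : R :=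
  (pi ^+ n)^-1 * expR (- \sum_(i < n) ComplexField.Normc.normc (z i 0) ^+ 2).

(* X is a circularly symmetric (about its mean) complex Gaussian vector: it has
   the law of m + A z with z ~ CN(0, I_k).  The matrix A is arbitrary, so that
   the law of X may be degenerate. *)
Definition circular_gaussian n (X : Omega -> 'cV[R[i]]_n) :=
  measurable_fun [set: Omega] X /\
  exists k (m : 'cV[R[i]]_n) (A : 'M[R[i]]_(n, k)),
    forall B : set 'cV[R[i]]_n, measurable B ->
      P (X @^-1` B) = (\int[lebesgue_cV R k]_(z in [set z | B (m + A *m z)%R])
                         (std_cgauss_pdf z)%:E)%E.

Definition cexpectation (f : Omega -> R[i]) : R[i] :=
  (\int[P]_(omega in [set: Omega]) complex.Re (f omega))
  +i* (\int[P]_(omega in [set: Omega]) complex.Im (f omega)).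

(* CN(mu, Lambda); a Gaussian vector has finite moments, so that cexpectation
   is here the actual expectation. *)
Definition complex_normal n (X : Omega -> 'cV[R[i]]_n)
    (mu : 'cV[R[i]]_n) (Lambda : 'M[R[i]]_n) :=
  [/\ circular_gaussian X,
      forall i, cexpectation (fun omega => X omega i 0) = mu i 0 &
      forall i j, cexpectation (fun omega =>
        ((X omega - mu) *m (X omega - mu)^t* ) i j) = Lambda i j].

(* The uniform law on [-pi, pi], which is also that on ]-pi, pi]. *)
Definition uniform_phase (Theta : Omega -> R) :=
  forall B : set R, measurable B ->
    P (Theta @^-1` B) = uniform_prob (gtrN (pi_gt0 R)) B.

(* Taking some of the sets to be setT gives the product rule for subfamilies. *)
Definition mutually_independent3 d1 d2 d3 (T1 : measurableType d1)
    (T2 : measurableType d2) (T3 : measurableType d3)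
    (X : Omega -> T1) (Y : Omega -> T2) (Z : Omega -> T3) :=
  forall (A : set T1) (B : set T2) (C : set T3),
    measurable A -> measurable B -> measurable C ->
    P (X @^-1` A `&` Y @^-1` B `&` Z @^-1` C) =
    (P (X @^-1` A) * P (Y @^-1` B) * P (Z @^-1` C))%E.

End complex_random_vectors.

Definition psd (R : realType) n (A : 'M[R]_n) :=
  A^T = A /\ forall x : 'cV[R]_n, 0 <= (x^T *m A *m x) 0 0.

Definition expj (R : realType) (t : R) : R[i] := cos t +i* sin t.

Definition bessel_I0 (R : realType) (z : R) : R :=
  pi^-1 * \int[lebesgue_measure]_(eta in `[0, pi]) expR (z * cos eta).

(* The covariance rho D_s Lambda_h D_s^dagger + I_T of y for a fixed phase. *)
Definition cov_output (R : realType) T (rho : R) (s : 'cV[R[i]]_T)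
    (Lambda_h : 'M[R]_T) : 'M[R[i]]_T :=
  rho%:C *: (diag_mx s^T *m map_mx (real_complex R) Lambda_h
             *m (diag_mx s^T)^t* ) + 1%:M.

(* The next lemmas show that the determinant of cov_output and the Hermitian
   forms of its inverse are real, so that taking their real parts only changes
   their type from R[i] to R. *)
Section realness.
Variables (R : realType) (n : nat) (A : 'M[R[i]]_n).
Hypothesis A_herm : A^t* = A.

Lemma hermitian_inv : (invmx A)^t* = invmx A.
Proof. by rewrite trmx_inv map_invmx A_herm. Qed.

Lemma conj_fix_Im0 (z : R[i]) : z^*%R = z -> complex.Im z = 0.
Proof.
case: z => a b [] /eqP; rewrite eq_sym -addr_eq0 -mulr2n mulrn_eq0 => /eqP.
by [].
Qed.

Lemma hermitian_det_Im0 : complex.Im (\det A) = 0.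
Proof. by apply: conj_fix_Im0; rewrite -[in RHS]A_herm det_map_mx det_tr. Qed.

Lemma hermitian_form_Im0 (x : 'cV[R[i]]_n) :
  complex.Im ((x^t* *m A *m x) 0 0) = 0.
Proof.
apply: conj_fix_Im0.
have <- : ((x^t* *m A *m x)^t* ) 0 0 = ((x^t* *m A *m x) 0 0)^*%R by rewrite !mxE.
rewrite !trmx_mul !map_mxM A_herm trmxCK mulmxA.
by [].
Qed.
End realness.

Lemma cov_output_hermitian (R : realType) T (rho : R) (s : 'cV[R[i]]_T)
    (Lambda_h : 'M[R]_T) :
  Lambda_h^T = Lambda_h ->
  (cov_output rho s Lambda_h)^t* = cov_output rho s Lambda_h.
Proof.
move=> sym; have rC (r : R) : (r%:C)^*%R = r%:C by exact: conjc_real.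
have LC : (map_mx (real_complex R) Lambda_h)^t* = map_mx (real_complex R) Lambda_h.
  by apply/matrixP => i j; rewrite 3!mxE rC -[in RHS]sym !mxE.
rewrite /cov_output linearD/= map_mxD trmx1 map_mx1 linearZ/= map_mxZ /= rC.
by rewrite !trmx_mul !map_mxM trmxCK LC mulmxA.
Qed.

(* Main.v *)
Require Import Defs.
From mathcomp Require Import all_boot all_order all_algebra.
From mathcomp Require Import all_classical all_reals all_analysis.
From mathcomp Require Import complex.
From mathcomp Require Import measurable_realfun ring lra.
Set Implicit Arguments.
Unset Strict Implicit.
Unset Printing Implicit Defensive.
Import Order.TTheory GRing.Theory Num.Theory.
Import numFieldNormedType.Exports.
Local Open Scope classical_set_scope.
Local Open Scope complex_scope.
Local Open Scope sesquilinear_scope.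
Local Open Scope ring_scope.

(** For a fixed phase the law of [y] is that of [c + M z + w], with [z] and [w]
    standard complex Gaussian vectors and [M M^dagger + I] the covariance
    [cov_output], which does not depend on the phase.  No linear change of
    variables on [C^T] is needed: the translation invariance of the Lebesgue
    measure reduces the density to the integral over [z] of
    [std_cgauss_pdf z * std_cgauss_pdf (v - c - M z)], and this integral is
    computed one column of [M] at a time, each column being a rank-one update
    of the covariance (matrix determinant lemma, Sherman-Morrison formula and
    completion of the square in one complex variable).
    The parameters of the law of [h] are recovered from its first two moments:
    if [h] has the law of [m + A z], then [m = mu_h] and
    [A A^dagger = Lambda_h].
    Averaging over the phase the factor [exp (2 Re (e^(j t) q))] gives
    [I_0 (2 |q|)], since [cos] is even and periodic. *)

(** * Gaussian integrals on the real line *)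

(** The vector [h] may be degenerate and then has no density, so all the smoothness of the law of
    [y] comes from the noise; the law of [h] is used only as the image of a standard Gaussian law
    under [z -> m + A z]. The matrix [A] is not determined by that law, but [A A^dagger] is, and
    nothing else about [A] enters the result. The phase leaves the covariance alone because
    [e^(j t)] has modulus 1; after expansion of the quadratic form it survives only in the cross
    term between [v] and the mean. The integrands that build the density are nonnegative, so Tonelli
    applies with no integrability condition. The moments of [h] involve signed integrands;
    polarization reduces them to integrals of squares, which are again nonnegative. *)

Section real_line.
Variable R : realType.
Local Notation mu := (@lebesgue_measure R).
Local Open Scope ereal_scope.

(** Lebesgue measure is characterized by its values on the intervals []a, b]], whose preimages under
    the translation are intervals of the same length. *)
Lemma lebesgue_measure_shift (c : R) (A : set R) : measurable A ->
  pushforward mu (fun x : measurableTypeR R => (x + c)%R : measurableTypeR R) A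
  = mu A.
Proof.
have mc : measurable_fun setT
  (fun x : measurableTypeR R => (x + c)%R : measurableTypeR R).
  exact: measurable_funD.
move=> mA; apply/esym.
pose m := measure_function_pushforward__canonical__measure_function_Measure mu mc.
apply: (@lebesgue_measure_unique R m) => //= _ [[a b]] _ <-.
rewrite /m /= /pushforward.
rewrite (_ : _ @^-1` _ = `](a - c)%R, (b - c)%R]%classic).
  rewrite !lebesgue_measure_itv/= !lte_fin ltrD2r.
  by rewrite -!EFinB opprB addrA subrK.
by apply/seteqP; split => x /=; rewrite !in_itv/= ltrBlDr lerBrDr.
Qed.

Lemma ge0_integral_shift (c : R) (f : R -> \bar R) :
  measurable_fun [set: R] f -> (forall x, 0 <= f x) ->
  \int[mu]_x f (x + c)%R = \int[mu]_x f x.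
Proof.
move=> mf f0.
have mc : measurable_fun setT
  (fun x : measurableTypeR R => (x + c)%R : measurableTypeR R).
  exact: measurable_funD.
have := @ge0_integral_pushforward _ _ _ _ _ _ mc mu setT f measurableT mf.
rewrite preimage_setT => <- //.
by apply: eq_measure_integral => A mA _; exact: lebesgue_measure_shift.
Qed.

Lemma ge0_integral_opp (f : R -> \bar R) :
  measurable_fun [set: R] f -> (forall x, 0 <= f x) ->
  \int[mu]_x f (- x)%R = \int[mu]_x f x.
Proof.
move=> mf f0.
have mc : measurable_fun setT (-%R : measurableTypeR R -> measurableTypeR R).
  exact: measurable_funN.
have := @ge0_integral_pushforward _ _ _ _ _ _ mc mu setT f measurableT mf.
rewrite preimage_setT => <- //.
by apply: eq_measure_integral => A mA _; exact: lebesgue_measureN.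
Qed.

(** Up to a constant factor the integrand is the normal density of mean [p / s] and variance
    [1 / (2 s)]. *)
Lemma integral_expR_quadratic (s p : R) : (0 < s)%R ->
  \int[mu]_x (expR (- s * x ^+ 2 + 2 * p * x))%:E =
  (Num.sqrt (pi / s) * expR (p ^+ 2 / s))%:E.
Proof.
move=> s0; pose sg : R := ((Num.sqrt (2 * s))^-1)%R.
have sg2 : (sg ^+ 2 = (2 * s)^-1)%R.
  by rewrite /sg exprVn sqr_sqrtr// mulr_ge0// ltW.
have sg0 : sg != 0%R.
  by rewrite /sg invr_eq0 sqrtr_eq0 -ltNge mulr_gt0.
have H := integral_normal_pdf (p / s)%R sg.
have K0 : (0 < Num.sqrt (pi / s))%R by rewrite sqrtr_gt0 divr_gt0// pi_gt0.
transitivity (\int[mu]_x ((Num.sqrt (pi / s) * expR (p ^+ 2 / s))%:E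
    * (normal_pdf (p / s) sg x)%:E)).
  apply: eq_integral => x _; rewrite -EFinM normal_pdfE// /normal_peak /normal_fun.
  rewrite sg2; congr EFin.
  have -> : ((2 * s)^-1 * pi *+ 2 = pi / s)%R.
    by rewrite -mulr_natr; field; rewrite gt_eqF.
  rewrite mulrACA divff ?gt_eqF// mul1r -expRD; congr expR.
  by rewrite -mulr_natr; field; rewrite gt_eqF.
rewrite ge0_integralZl//=.
- by rewrite H mule1.
- by apply/measurable_EFinP; exact: measurable_normal_pdf.
- by move=> x _; rewrite lee_fin normal_pdf_ge0.
Qed.

(** Integration by parts of [x * (x e^(-x^2))] on [[0, n + 1]] leaves half the Gaussian integral and
    a boundary term that vanishes in the limit. *)
Lemma integral0y_sqr_gauss :
  \int[mu]_(x in `[0%R, +oo[) (x ^+ 2 * gauss_fun x)%:E =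
  (Num.sqrt pi / 4)%:E.
Proof.
have mf : measurable_fun setT (fun x : R => x ^+ 2 * gauss_fun x)%R.
  by apply: measurable_funM; [exact: measurable_funX|exact: measurable_gauss_fun].
have f0 (x : R) : (0 <= x ^+ 2 * gauss_fun x)%R.
  by rewrite mulr_ge0 ?sqr_ge0 ?gauss_fun_ge0.
have parts (n : nat) : \int[mu]_(x in `[0%R, n.+1%:R]) (x ^+ 2 * gauss_fun x)%:E
    = (- (n.+1%:R * gauss_fun n.+1%:R) / 2)%:E +
      2^-1%:E * \int[mu]_(x in `[0%R, n.+1%:R]) (gauss_fun x)%:E.
  have dG (x : R) : is_derive x 1%R (fun x : R => - gauss_fun x / 2)%R
      (x * gauss_fun x)%R.
    rewrite /gauss_fun; apply: is_derive_eq.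
    by rewrite /GRing.scale/=; field.
  have cG : continuous (fun x : R => - gauss_fun x / 2)%R.
    by move=> x; apply: differentiable_continuous; apply/derivable1_diffP; exact: ex_derive.
  have cg : continuous (fun x : R => x * gauss_fun x)%R.
    by move=> x; apply: cvgM; [exact: cvg_id|exact: continuous_gauss_fun].
  have n0 : (0 < n.+1%:R :> R)%R by rewrite ltr0n.
  transitivity (\int[mu]_(x in `[0%R, n.+1%:R]) (id x * (x * gauss_fun x))%:E).
    by apply: eq_integral => x _; rewrite mulrA -expr2.
  rewrite (@integration_by_parts R id (fun x => - gauss_fun x / 2)%R (cst 1%R)
     (fun x => x * gauss_fun x)%R 0%R n.+1%:R n0).
  - under eq_integral do rewrite mul1r mulNr EFinN.
    rewrite mul0r subr0 integral_ge0N; last first.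
      by move=> x _; rewrite lee_fin divr_ge0// gauss_fun_ge0.
    rewrite oppeK; congr +%E; first by rewrite mulrA mulrN.
    under eq_integral do rewrite mulrC EFinM.
    rewrite ge0_integralZl//.
    + by apply: measurable_funTS; apply/measurable_EFinP; exact: measurable_gauss_fun.
    + by move=> x _; rewrite lee_fin gauss_fun_ge0.
  - by apply: continuous_subspaceT; exact: cst_continuous.
  - split => //.
    + by apply: cvg_at_right_filter; exact: cvg_id.
    + by apply: cvg_at_left_filter; exact: cvg_id.
  - by move=> x _; rewrite derive1E derive_id.
  - exact: continuous_subspaceT.
  - split => //.
    + by apply: cvg_at_right_filter; exact: cG.
    + by apply: cvg_at_left_filter; exact: cG.
  - by move=> x _; rewrite derive1E; apply: derive_val.
have lim1 := @ge0_cvgn_integral R mu _ f0 mf.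
have lim2 := @ge0_cvgn_integral R mu _ gauss_fun_ge0 measurable_gauss_fun.
rewrite integral0y_gauss in lim2.
(* The index is shifted because the integration by parts needs an interval of positive length. *)
rewrite -cvg_shiftS/= in lim1; rewrite -cvg_shiftS/= in lim2.
apply: (cvg_unique _ lim1) => //.
rewrite (funext parts).
rewrite (_ : (_ / 4)%:E = 0 + 2^-1%:E * (Num.sqrt pi / 2)%:E); last first.
  by rewrite add0e -EFinM; congr EFin; field.
apply: cvgeD => //; last by apply: cvgeZl.
apply: cvg_EFin; first by apply: nearW.
apply/cvgrPdist_le => e e0.
near=> n; rewrite /= sub0r normrN mulNr normrN ger0_norm; last first.
  by rewrite divr_ge0// mulr_ge0// gauss_fun_ge0.
have n0 : (0 < n.+1%:R :> R)%R by rewrite ltr0n.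
apply: (@le_trans _ _ (n.+1%:R^-1)%R); last first.
  by apply: ltW; near: n; exact: (near_infty_natSinv_lt (PosNum e0)).
rewrite ler_pdivrMr//.
(* From [e^(x^2) >= 1 + x^2 >= x^2]; hence the boundary term is at most [1 / (n + 1)]. *)
have : (gauss_fun n.+1%:R <= (n.+1%:R ^+ 2)^-1 :> R)%R.
  rewrite /gauss_fun expRN lef_pV2 ?posrE ?expR_gt0 ?exprn_gt0//.
  by apply: le_trans (expR_ge1Dx _); rewrite lerDr.
rewrite expr2 invfM => H.
have := ler_wpM2l (ltW n0) H; rewrite mulVKf ?gt_eqF// => /le_trans; apply.
by rewrite ler_peMr// ?invr_ge0 ?ltW// ltr1n.
Unshelve. all: end_near. Qed.

Lemma integral_sqr_gauss :
  \int[mu]_x (x ^+ 2 * gauss_fun x)%:E = (Num.sqrt pi / 2)%:E.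
Proof.
rewrite ge0_symfun_integralT//=.
- rewrite (_ : [set x | _] = `[0%R, +oo[%classic); last first.
    by apply/seteqP; split => x/=; rewrite in_itv/= andbT.
  by rewrite integral0y_sqr_gauss -EFinM; congr EFin; field.
- by move=> x; rewrite mulr_ge0 ?sqr_ge0 ?gauss_fun_ge0.
- move=> x; apply: cvgM; last exact: continuous_gauss_fun.
  exact: exprn_continuous.
- by move=> x/=; rewrite /gauss_fun sqrrN.
Qed.

(* Averaging over x and -x removes the cross term. *)
Lemma integral_affine_sqr_gauss (a p : R) :
  \int[mu]_x ((a + p * x) ^+ 2 * (gauss_fun x / Num.sqrt pi))%:E =
  (a ^+ 2 + p ^+ 2 / 2)%:E.
Proof.
have sp0 : (0 < Num.sqrt pi :> R)%R by rewrite sqrtr_gt0 pi_gt0.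
have mg : measurable_fun setT (fun x : R => gauss_fun x / Num.sqrt pi)%R.
  by apply: measurable_funM => //; exact: measurable_gauss_fun.
have g0 (x : R) : (0 <= gauss_fun x / Num.sqrt pi)%R.
  by rewrite divr_ge0 ?gauss_fun_ge0// ltW.
set I := LHS.
have mI (b : R) : measurable_fun setT
    (fun x : R => ((a + b * x) ^+ 2 * (gauss_fun x / Num.sqrt pi))%:E).
  apply/measurable_EFinP/measurable_funM => //; apply: measurable_funX.
  by apply: measurable_funD => //; exact: measurable_funM.
have I0 (b x : R) : 0 <= ((a + b * x) ^+ 2 * (gauss_fun x / Num.sqrt pi))%:E.
  by rewrite lee_fin mulr_ge0 ?sqr_ge0.
have IN : I = \int[mu]_x ((a + - p * x) ^+ 2 * (gauss_fun x / Num.sqrt pi))%:E.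
  rewrite /I -ge0_integral_opp//; apply: eq_integral => x _.
  by rewrite /gauss_fun sqrrN mulrN mulNr.
have : I + I = (2 * (a ^+ 2 + p ^+ 2 / 2))%:E.
  rewrite {2}IN -ge0_integralD//; [|exact: mI|exact: mI].
  transitivity (\int[mu]_x ((2 * a ^+ 2 / Num.sqrt pi)%:E * (gauss_fun x)%:E +
      (2 * p ^+ 2 / Num.sqrt pi)%:E * (x ^+ 2 * gauss_fun x)%:E)).
    by apply: eq_integral => x _; rewrite -!EFinM -!EFinD; congr EFin; ring.
  have mG : measurable_fun setT (EFin \o @gauss_fun R).
    by apply/measurable_EFinP; exact: measurable_gauss_fun.
  have mG2 : measurable_fun setT (fun x : R => (x ^+ 2 * gauss_fun x)%:E).
    apply/measurable_EFinP/measurable_funM; [exact: measurable_funX|].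
    exact: measurable_gauss_fun.
  have c1 : 0 <= (2 * a ^+ 2 / Num.sqrt pi)%:E.
    by rewrite lee_fin; apply: divr_ge0 => //; apply: mulr_ge0 => //; exact: sqr_ge0.
  have c2 : 0 <= (2 * p ^+ 2 / Num.sqrt pi)%:E.
    by rewrite lee_fin; apply: divr_ge0 => //; apply: mulr_ge0 => //; exact: sqr_ge0.
  have G0 (x : R) : 0 <= (gauss_fun x)%:E by rewrite lee_fin gauss_fun_ge0.
  have G20 (x : R) : 0 <= (x ^+ 2 * gauss_fun x)%:E.
    by rewrite lee_fin mulr_ge0 ?sqr_ge0 ?gauss_fun_ge0.
  rewrite ge0_integralD//; last 4 first.
  - by move=> x _; exact: mule_ge0.
  - exact: measurable_funeM.
  - by move=> x _; exact: mule_ge0.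
  - exact: measurable_funeM.
  rewrite !ge0_integralZl// integralT_gauss integral_sqr_gauss.
  by rewrite -!EFinM -EFinD; congr EFin; field; rewrite gt_eqF.
have : 0 <= I by apply: integral_ge0 => x _; exact: I0.
case: I {IN} => [r _| //|//].
by rewrite -EFinD => -[H]; congr EFin; lra.
Qed.

End real_line.

(** * Measurability and integration on complex vectors *)

Section complex_measurability.
Context d (X : measurableType d) (R : realType).
Implicit Types f g : X -> R[i].

Lemma measurable_fun_complex f :
  measurable_fun setT (fun x => complex.Re (f x)) ->
  measurable_fun setT (fun x => complex.Im (f x)) -> measurable_fun setT f.
Proof.
move=> mr mi.
rewrite (_ : f = @complex_of_pair R \o (fun x => (complex.Re (f x), complex.Im (f x)))).
  apply: measurableT_comp; first exact: measurable_complex_of_pair.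
  exact: measurable_fun_pair.
by apply/funext => x; rewrite /complex_of_pair /=; case: (f x).
Qed.

Lemma measurable_fun_Re f :
  measurable_fun setT f -> measurable_fun setT (fun x => complex.Re (f x)).
Proof. by move=> mf; apply: measurableT_comp => //; exact: measurable_Re. Qed.

Lemma measurable_fun_Im f :
  measurable_fun setT f -> measurable_fun setT (fun x => complex.Im (f x)).
Proof. by move=> mf; apply: measurableT_comp => //; exact: measurable_Im. Qed.

Lemma measurable_fun_addc f g : measurable_fun setT f -> measurable_fun setT g ->
  measurable_fun setT (fun x => f x + g x).
Proof.
move=> mf mg; apply: measurable_fun_complex.
  under eq_fun do rewrite raddfD.
  by apply: measurable_funD; exact: measurable_fun_Re.
under eq_fun do rewrite raddfD.
by apply: measurable_funD; exact: measurable_fun_Im.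
Qed.

Lemma measurable_fun_oppc f : measurable_fun setT f ->
  measurable_fun setT (fun x => - f x).
Proof.
move=> mf; apply: measurable_fun_complex.
  under eq_fun do rewrite raddfN.
  by apply: measurable_funN; exact: measurable_fun_Re.
under eq_fun do rewrite raddfN.
by apply: measurable_funN; exact: measurable_fun_Im.
Qed.

Lemma measurable_fun_mulc f g : measurable_fun setT f -> measurable_fun setT g ->
  measurable_fun setT (fun x => f x * g x).
Proof.
move=> mf mg; have [? ?] := (measurable_fun_Re mf, measurable_fun_Im mf).
have [? ?] := (measurable_fun_Re mg, measurable_fun_Im mg).
apply: measurable_fun_complex.
  rewrite (_ : (fun x => _) = (fun x => complex.Re (f x) * complex.Re (g x)
     - complex.Im (f x) * complex.Im (g x))).
    by apply: measurable_funB; exact: measurable_funM.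
  by apply/funext => x; case: (f x) => ? ?; case: (g x).
rewrite (_ : (fun x => _) = (fun x => complex.Re (f x) * complex.Im (g x)
     + complex.Im (f x) * complex.Re (g x))).
  by apply: measurable_funD; exact: measurable_funM.
by apply/funext => x; case: (f x) => ? ?; case: (g x).
Qed.

Lemma measurable_fun_conjc f : measurable_fun setT f ->
  measurable_fun setT (fun x => (f x)^*%R).
Proof.
move=> mf; apply: measurable_fun_complex.
  rewrite (_ : (fun x => _) = (fun x => complex.Re (f x))).
    exact: measurable_fun_Re.
  by apply/funext => x; case: (f x).
rewrite (_ : (fun x => _) = (fun x => - complex.Im (f x))).
  by apply: measurable_funN; exact: measurable_fun_Im.
by apply/funext => x; case: (f x).
Qed.

Lemma measurable_fun_sumc (I : Type) (r : seq I) (F : I -> X -> R[i]) :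
  (forall i, measurable_fun setT (F i)) ->
  measurable_fun setT (fun x => \sum_(i <- r) F i x).
Proof.
move=> mF; elim: r => [|i r IH].
  by under eq_fun do rewrite big_nil; exact: measurable_cst.
by under eq_fun do rewrite big_cons; exact: measurable_fun_addc.
Qed.

Lemma measurable_fun_normc f : measurable_fun setT f ->
  measurable_fun setT (fun x => ComplexField.Normc.normc (f x)).
Proof.
move=> mf; have [? ?] := (measurable_fun_Re mf, measurable_fun_Im mf).
rewrite (_ : (fun x => _) = (@Num.sqrt R) \o
  (fun x => complex.Re (f x) ^+ 2 + complex.Im (f x) ^+ 2)).
  apply: measurableT_comp.
    by apply: continuous_measurable_fun; exact: sqrt_continuous.
  by apply: measurable_funD; exact: measurable_funX.
by apply/funext => x /=; case: (f x).
Qed.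

Lemma measurable_fun_entry m n (F : X -> 'M[R[i]]_(m, n)) i j :
  measurable_fun setT F -> measurable_fun setT (fun x => F x i j).
Proof. by move=> mF; exact: (measurableT_comp (measurable_entry i j) mF). Qed.

Lemma measurable_fun_addmx m n (F G : X -> 'M[R[i]]_(m, n)) :
  measurable_fun setT F -> measurable_fun setT G ->
  measurable_fun setT (fun x => F x + G x).
Proof.
move=> mF mG; apply: measurable_fun_mx => i j.
under eq_fun do rewrite mxE.
by apply: measurable_fun_addc; apply: measurable_fun_entry.
Qed.

Lemma measurable_fun_oppmx m n (F : X -> 'M[R[i]]_(m, n)) :
  measurable_fun setT F -> measurable_fun setT (fun x => - F x).
Proof.
move=> mF; apply: measurable_fun_mx => i j.
under eq_fun do rewrite mxE.
by apply: measurable_fun_oppc; exact: measurable_fun_entry.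
Qed.

Lemma measurable_fun_scalemx m n f (F : X -> 'M[R[i]]_(m, n)) :
  measurable_fun setT f -> measurable_fun setT F ->
  measurable_fun setT (fun x => f x *: F x).
Proof.
move=> mf mF; apply: measurable_fun_mx => i j.
under eq_fun do rewrite mxE.
by apply: measurable_fun_mulc => //; exact: measurable_fun_entry.
Qed.

Lemma measurable_fun_mulmx m n p (F : X -> 'M[R[i]]_(m, n))
    (G : X -> 'M[R[i]]_(n, p)) :
  measurable_fun setT F -> measurable_fun setT G ->
  measurable_fun setT (fun x => F x *m G x).
Proof.
move=> mF mG; apply: measurable_fun_mx => i j.
under eq_fun do rewrite mxE.
apply: measurable_fun_sumc => k.
by apply: measurable_fun_mulc; exact: measurable_fun_entry.
Qed.

Lemma measurable_fun_ctmx m n (F : X -> 'M[R[i]]_(m, n)) :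
  measurable_fun setT F -> measurable_fun setT (fun x => (F x)^t*).
Proof.
move=> mF; apply: measurable_fun_mx => i j.
under eq_fun do rewrite !mxE.
by apply: measurable_fun_conjc; exact: measurable_fun_entry.
Qed.

End complex_measurability.

(** * Tonelli and translation invariance on complex vectors *)

Section complex_integration.
Variable R : realType.
Local Notation mu := (@lebesgue_measure R).
Local Notation muC := (@lebesgue_complex R).
Local Open Scope ereal_scope.

Lemma ge0_integral_lebesgue_complex (f : R[i] -> \bar R) :
  measurable_fun setT f -> (forall z, 0 <= f z) ->
  \int[muC]_z f z = \int[mu]_x \int[mu]_y f (x +i* y).
Proof.
move=> mf f0; rewrite /lebesgue_complex.
rewrite ge0_integral_pushforward//; last exact: measurable_complex_of_pair.
rewrite preimage_setT fubini_tonelli1//; last by move=> x; exact: f0.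
by apply: measurableT_comp mf _; exact: measurable_complex_of_pair.
Qed.

Lemma ge0_integral_lebesgue_cVS n (f : 'cV[R[i]]_n.+1 -> \bar R) :
  measurable_fun setT f -> (forall z, 0 <= f z) ->
  \int[lebesgue_cV R n.+1]_v f v =
  \int[muC]_z \int[lebesgue_cV R n]_v f (cV_cons (z, v)).
Proof.
move=> mf f0; rewrite /= /cons_measure.
rewrite ge0_integral_pushforward//; last exact: measurable_cV_cons.
rewrite preimage_setT fubini_tonelli1//; last by move=> x; exact: f0.
by apply: measurableT_comp mf _; exact: measurable_cV_cons.
Qed.

Lemma ge0_integral_lebesgue_cV0 (f : 'cV[R[i]]_0 -> \bar R) :
  measurable_fun setT f -> (forall z, 0 <= f z) ->
  \int[lebesgue_cV R 0]_v f v = f 0%R.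
Proof. by move=> mf f0; rewrite /= integral_dirac// diracT mul1e. Qed.

Lemma measurable_complex_y (x : R) : measurable_fun setT (fun y : R => x +i* y).
Proof. by apply: measurable_fun_complex => /=. Qed.

Lemma ge0_integral_lebesgue_complex_shift (c : R[i]) (f : R[i] -> \bar R) :
  measurable_fun setT f -> (forall z, 0 <= f z) ->
  \int[muC]_z f (z + c)%R = \int[muC]_z f z.
Proof.
move=> mf f0; case: c => a b.
rewrite [LHS]ge0_integral_lebesgue_complex//; last first.
  by apply: measurableT_comp mf _; exact: measurable_fun_addc.
rewrite [RHS](ge0_integral_lebesgue_complex mf f0) -[RHS](ge0_integral_shift a).
- apply: eq_integral => x _; rewrite -[RHS](ge0_integral_shift b)//.
  by apply: measurableT_comp mf _; exact: measurable_complex_y.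
- apply: (@measurable_fun_fubini_tonelli_F _ _ _ _ _ _
    (fun p : measurableTypeR R * measurableTypeR R => f (p.1 +i* p.2))) => //.
  by apply: measurableT_comp mf _; exact: measurable_complex_of_pair.
- by move=> x; exact: integral_ge0.
Qed.

Lemma cV_consD n (z c : R[i]) (v w : 'cV[R[i]]_n) :
  cV_cons (z + c, v + w)%R = (cV_cons (z, v) + cV_cons (c, w))%R.
Proof.
apply/matrixP => i j; rewrite ord1 [RHS]mxE.
by case: (unliftP ord0 i) => [k|] ->; rewrite ?cV_consS ?cV_cons0//= mxE.
Qed.

Lemma cV_cons_surj n (v : 'cV[R[i]]_n.+1) :
  exists z w, v = cV_cons (z, w).
Proof.
exists (v ord0 ord0), (dsubmx (v : 'cV_(1 + n))).
apply/matrixP => i j; rewrite ord1; case: (unliftP ord0 i) => [k|] ->.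
  rewrite cV_consS /= mxE; congr (v _ _); exact: val_inj.
by rewrite cV_cons0.
Qed.

Lemma measurable_cV_cons_y n (z : R[i]) :
  measurable_fun setT (fun v : 'cV[R[i]]_n => cV_cons (z, v)).
Proof.
apply: measurableT_comp; first exact: measurable_cV_cons.
exact: measurable_fun_pair.
Qed.

Lemma ge0_integral_lebesgue_cV_shift n (c : 'cV[R[i]]_n)
    (f : 'cV[R[i]]_n -> \bar R) :
  measurable_fun setT f -> (forall z, 0 <= f z) ->
  \int[lebesgue_cV R n]_v f (v + c)%R = \int[lebesgue_cV R n]_v f v.
Proof.
elim: n c f => [|n IH] c f mf f0.
  by apply: eq_integral => v _; rewrite [c]flatmx0 addr0.
rewrite [LHS]ge0_integral_lebesgue_cVS//; last first.
  apply: measurableT_comp mf _; exact: measurable_fun_addmx.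
rewrite [RHS](ge0_integral_lebesgue_cVS mf f0); have [a [b ->]] := cV_cons_surj c.
rewrite -[RHS](ge0_integral_lebesgue_complex_shift a).
- apply: eq_integral => x _.
  rewrite -[RHS](IH b)//.
    by apply: eq_integral => y _; rewrite -cV_consD.
  by apply: measurableT_comp mf _; exact: measurable_cV_cons_y.
- apply: (@measurable_fun_fubini_tonelli_F _ _ _ _ _ _
    (f \o @cV_cons R n)) => //.
  by apply: measurableT_comp mf _; exact: measurable_cV_cons.
- by move=> x; exact: f0.
- by move=> x; apply: integral_ge0 => v _; exact: f0.
Qed.

End complex_integration.

(** * Hermitian positive definite matrices *)

Section rank_one_update.
Variables (F : fieldType) (n : nat) (L : 'M[F]_n) (a : 'cV[F]_n) (b : 'rV[F]_n).
Hypothesis uL : L \in unitmx.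
Let K := invmx L.
Let alpha := (b *m K *m a) 0 0.

(** Both sides are the determinant of the bordered matrix [M]: one unitriangular factor clears its
    upper right block, the other its lower left block. *)
Lemma det_rank_one_update : \det (L + a *m b) = \det L * (1 + alpha).
Proof.
pose M := block_mx (1%:M : 'M[F]_1) (- b) a L.
have <- : \det M = \det (L + a *m b).
  have : \det (M *m block_mx 1%:M b 0 1%:M) = \det (L + a *m b).
    rewrite mulmx_block !mulmx1 !mulmx0 !mul1mx !addr0 addrN.
    by rewrite det_lblock det1 mul1r addrC.
  by rewrite det_mulmx det_ublock !det1 !mulr1.
have : \det (M *m block_mx 1%:M 0 (- (K *m a)) 1%:M) = \det L * (1 + alpha).
  rewrite mulmx_block !mulmx1 !mulmx0 !mulmxN mulNmx opprK mulKVmx// addrN.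
  by rewrite det_ublock det_mx11 add0r mulrC mulmxA 2!mxE.
by rewrite det_mulmx det_lblock !det1 !mulr1.
Qed.

Lemma invmx_rank_one_update : 1 + alpha != 0 ->
  invmx (L + a *m b) = K - (1 + alpha)^-1 *: (K *m a *m (b *m K)).
Proof.
move=> alpha0.
have uL' : L + a *m b \in unitmx.
  by rewrite unitmxE det_rank_one_update unitrM -unitmxE uL unitfE.
apply: (can_inj (mulKmx uL')); rewrite mulmxV// mulmxBr mulmxDl mulmxV//.
rewrite -scalemxAr mulmxDl [L *m _]mulmxA mulKVmx//.
(* The inner product [b K a] is a 1 x 1 matrix, so it comes out as the scalar [alpha]. *)
have -> : a *m b *m (K *m a *m (b *m K)) = alpha *: (a *m (b *m K)).
  rewrite -!mulmxA [b *m (K *m _)]mulmxA [b *m K *m _]mulmxA.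
  by rewrite [b *m K *m a]mx11_scalar mul_scalar_mx -scalemxAr.
by rewrite -mulmxA -[X in X + alpha *: _]scale1r -scalerDl scalerA mulVf// scale1r addrK.
Qed.

End rank_one_update.

Section hermitian_forms.
Variable R : realType.
Local Notation C := R[i].

Lemma ctmxD m n (A B : 'M[C]_(m, n)) : (A + B)^t* = A^t* + B^t*.
Proof. by rewrite linearD/= map_mxD. Qed.

Lemma ctmxN m n (A : 'M[C]_(m, n)) : (- A)^t* = - A^t*.
Proof. by rewrite linearN/= map_mxN. Qed.

Lemma ctmxZ m n (z : C) (A : 'M[C]_(m, n)) : (z *: A)^t* = z^*%R *: A^t*.
Proof. by rewrite linearZ/= map_mxZ. Qed.

Lemma ctmxM m n p (A : 'M[C]_(m, n)) (B : 'M[C]_(n, p)) :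
  (A *m B)^t* = B^t* *m A^t*.
Proof. by rewrite trmx_mul map_mxM. Qed.

Lemma ctmx00 (A : 'M[C]_1) : (A 0 0)^*%R = (A^t*) 0 0.
Proof. by rewrite !mxE. Qed.

(* Positive semidefiniteness and the positive determinant together say that
   [L] is Hermitian positive definite. *)
Definition hermitian_posdef n (L : 'M[C]_n) :=
  [/\ L^t* = L, forall x : 'cV_n, 0 <= (x^t* *m L *m x) 0 0 & 0 < \det L].

Lemma hermitian_posdef1 n : hermitian_posdef (1%:M : 'M[C]_n).
Proof.
split; first by rewrite trmx1 map_mx1.
- move=> x; rewrite mulmx1 mxE sumr_ge0// => i _.
  by rewrite !mxE mulrC mul_conjC_ge0.
- by rewrite det1.
Qed.

Lemma hermitian_posdef_unit n (L : 'M[C]_n) : hermitian_posdef L -> L \in unitmx.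
Proof. by case=> _ _ d; rewrite unitmxE unitfE gt_eqF. Qed.

(** This is the form of [L] evaluated at [L^-1 x]. *)
Lemma hermitian_posdef_inv_ge0 n (L : 'M[C]_n) (x : 'cV_n) :
  hermitian_posdef L -> 0 <= (x^t* *m invmx L *m x) 0 0.
Proof.
move=> pL; have uL := hermitian_posdef_unit pL; have [hL nL _] := pL.
have := nL (invmx L *m x); rewrite ctmxM hermitian_inv//.
by rewrite -!mulmxA mulKVmx// mulmxA.
Qed.

(** The form gains the term [|a^dagger x|^2], and the determinant is multiplied by
    [1 + a^dagger L^-1 a], which is at least 1. *)
Lemma hermitian_posdef_rank_one n (L : 'M[C]_n) (a : 'cV_n) :
  hermitian_posdef L -> hermitian_posdef (L + a *m a^t*).
Proof.
move=> pL; have uL := hermitian_posdef_unit pL; have [hL nL dL] := pL.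
split; first by rewrite ctmxD ctmxM trmxCK hL.
- move=> x; rewrite mulmxDr mulmxDl mxE addr_ge0// mulmxA -mulmxA.
  rewrite mxE big_ord1.
  have -> : (x^t* *m a) 0 0 = ((a^t* *m x) 0 0)^*%R.
    by rewrite ctmx00 ctmxM trmxCK.
  by rewrite mulrC mul_conjC_ge0.
- rewrite det_rank_one_update// mulr_gt0// ltr_wpDr//.
  exact: hermitian_posdef_inv_ge0.
Qed.

(** The density of CN(0, L) when [L] is Hermitian positive definite; the determinant and the form
    are then real, and [complex.Re] only changes their type. *)
Definition cgauss_pdf n (L : 'M[C]_n) (v : 'cV[C]_n) : R :=
  (pi ^+ n * complex.Re (\det L))^-1
  * expR (- complex.Re ((v^t* *m invmx L *m v) 0 0)).

Lemma cgauss_pdf1 n : cgauss_pdf (1%:M : 'M[C]_n) = @std_cgauss_pdf R n.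
Proof.
apply/funext => v; rewrite /cgauss_pdf /std_cgauss_pdf det1 mulr1 invmx1 mulmx1.
congr (_ * expR (- _)); rewrite mxE raddf_sum/=; apply: eq_bigr => i _.
rewrite !mxE; case: (v i 0) => x y /=.
by rewrite sqr_sqrtr ?addr_ge0 ?sqr_ge0// !expr2 mulNr opprK.
Qed.

Lemma Re_det_gt0 n (L : 'M[C]_n) : hermitian_posdef L -> 0 < complex.Re (\det L).
Proof. by case=> _ _; rewrite ltcE => /andP[]. Qed.

Lemma cgauss_pdf_ge0 n (L : 'M[C]_n) v : hermitian_posdef L -> 0 <= cgauss_pdf L v.
Proof.
move=> pL; rewrite mulr_ge0 ?expR_ge0// invr_ge0 mulr_ge0// ?exprn_ge0 ?pi_ge0//.
exact/ltW/Re_det_gt0.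
Qed.

Lemma measurable_cgauss_pdf n (L : 'M[C]_n) : measurable_fun setT (cgauss_pdf L).
Proof.
apply: measurable_funM => //; apply: measurableT_comp => //.
apply: measurable_funN; apply: measurable_fun_Re; apply: measurable_fun_entry.
apply: measurable_fun_mulmx => //; apply: measurable_fun_mulmx => //.
exact: measurable_fun_ctmx.
Qed.

End hermitian_forms.

(** * Complex Gaussian integrals *)

Section gaussian_integrals.
Variable R : realType.
Local Notation C := R[i].
Local Notation mu := (@lebesgue_measure R).
Local Notation muC := (@lebesgue_complex R).
Local Notation normc := ComplexField.Normc.normc.

Definition scalar_cgauss_pdf (z : C) : R := pi^-1 * expR (- normc z ^+ 2).

Lemma scalar_cgauss_pdf_ge0 z : 0 <= scalar_cgauss_pdf z.
Proof. by rewrite mulr_ge0 ?expR_ge0// invr_ge0 pi_ge0. Qed.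

Lemma measurable_scalar_cgauss_pdf : measurable_fun setT scalar_cgauss_pdf.
Proof.
apply: measurable_funM => //; apply: measurableT_comp => //.
by apply: measurable_funN; apply: measurable_funX; exact: measurable_fun_normc.
Qed.

Lemma sqr_normcE (x y : R) : normc (x +i* y) ^+ 2 = x ^+ 2 + y ^+ 2.
Proof. by rewrite /= sqr_sqrtr// addr_ge0 ?sqr_ge0. Qed.

Lemma std_cgauss_pdf_ge0 n (v : 'cV[C]_n) : 0 <= std_cgauss_pdf v.
Proof. by rewrite mulr_ge0 ?expR_ge0// invr_ge0 exprn_ge0 ?pi_ge0. Qed.

Lemma measurable_std_cgauss_pdf n : measurable_fun setT (@std_cgauss_pdf R n).
Proof. by rewrite -cgauss_pdf1; exact: measurable_cgauss_pdf. Qed.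

Lemma std_cgauss_pdf_cons n (z : C) (v : 'cV[C]_n) :
  std_cgauss_pdf (cV_cons (z, v)) = scalar_cgauss_pdf z * std_cgauss_pdf v.
Proof.
rewrite /std_cgauss_pdf /scalar_cgauss_pdf mulrACA -expRD -invfM -exprS.
congr (_ * expR _); rewrite big_ord_recl opprD cV_cons0.
by under eq_bigr do rewrite cV_consS.
Qed.

(** The two cross terms are conjugate to each other, so their real parts add up. The matrix products
    are replaced by plain scalars to bring the identity within reach of [ring]. *)
Lemma Re_quadratic_expansion (z w b r c : C) : w = b^*%R -> complex.Im r = 0 ->
  complex.Re (c - z * w - z^*%R * b + z^*%R * z * r) =
  complex.Re c - 2 * (complex.Re z * complex.Re b + complex.Im z * complex.Im b)
  + normc z ^+ 2 * complex.Re r.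
Proof.
move=> ->; case: z b r c => x y [p q] [r t] [c d] /= ->.
by rewrite sqr_sqrtr ?addr_ge0 ?sqr_ge0//; ring.
Qed.

(** Serves twice: with [z] a Gaussian integration variable in the rank-one update, and with
    [z = e^(j t)] in the average over the phase. *)
Lemma Re_hermitian_form_sub n (K : 'M[C]_n) (a v : 'cV[C]_n) (z : C) : K^t* = K ->
  complex.Re (((v - z *: a)^t* *m K *m (v - z *: a)) 0 0) =
  complex.Re ((v^t* *m K *m v) 0 0)
  - 2 * (complex.Re z * complex.Re ((a^t* *m K *m v) 0 0)
         + complex.Im z * complex.Im ((a^t* *m K *m v) 0 0))
  + normc z ^+ 2 * complex.Re ((a^t* *m K *m a) 0 0).
Proof.
move=> hK.
have vKa : (v^t* *m K *m a) 0 0 = ((a^t* *m K *m v) 0 0)^*%R.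
  by rewrite ctmx00 !ctmxM trmxCK hK mulmxA.
have -> : ((v - z *: a)^t* *m K *m (v - z *: a)) 0 0 =
    (v^t* *m K *m v) 0 0 - z * (v^t* *m K *m a) 0 0
    - z^*%R * (a^t* *m K *m v) 0 0 + z^*%R * z * (a^t* *m K *m a) 0 0.
  rewrite ctmxD ctmxN ctmxZ !mulmxBl -2!scalemxAl 2!mulmxBr -2!scalemxAr.
  move: (v^t* *m K *m v) (v^t* *m K *m a) (a^t* *m K *m v) (a^t* *m K *m a).
  by move=> p q r t; rewrite !mxE; ring.
exact: Re_quadratic_expansion vKa (hermitian_form_Im0 hK a).
Qed.

(** Separates the real and imaginary parts of the integration variable, so that each factor is in
    the form of [integral_expR_quadratic] with [s = 1 + A]. Here [i] stands for [pi^-1] and [d] for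
    the normalizing constant of [cgauss_pdf]. *)
Lemma complete_square_expR (i d V A p q x y : R) :
  i * expR (- (x ^+ 2 + y ^+ 2)) *
    (d * expR (- (V - 2 * (x * p + y * q) + (x ^+ 2 + y ^+ 2) * A))) =
  d * expR (- V) * i * (expR (- (1 + A) * x ^+ 2 + 2 * p * x) *
    expR (- (1 + A) * y ^+ 2 + 2 * q * y)).
Proof.
transitivity (d * i * expR (- (x ^+ 2 + y ^+ 2) +
    - (V - 2 * (x * p + y * q) + (x ^+ 2 + y ^+ 2) * A))).
  by rewrite expRD; ring.
transitivity (d * i * (expR (- V) * expR (- (1 + A) * x ^+ 2 + 2 * p * x +
    (- (1 + A) * y ^+ 2 + 2 * q * y)))); last by rewrite expRD; ring.
by rewrite -expRD; congr (_ * expR _); ring.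
Qed.

(** Adding [z a], with [z] of law CN(0, 1), to an independent CN(0, L) vector adds [a a^dagger] to
    its covariance. *)
Lemma integral_cgauss_pdf_rank_one n (L : 'M[C]_n) (a v : 'cV[C]_n) :
  hermitian_posdef L ->
  (\int[muC]_z (scalar_cgauss_pdf z * cgauss_pdf L (v - z *: a))%:E =
   (cgauss_pdf (L + a *m a^t*) v)%:E)%E.
Proof.
move=> pL; have uL := hermitian_posdef_unit pL; have [hL _ dL] := pL.
have hK := hermitian_inv hL.
pose b := (a^t* *m invmx L *m v) 0 0.
pose A := complex.Re ((a^t* *m invmx L *m a) 0 0).
have AE : (a^t* *m invmx L *m a) 0 0 = A%:C.
  have := hermitian_form_Im0 hK a; rewrite /A.
  by case: (X in complex.Im X) => x y /= ->.
have A0 : 0 < 1 + A.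
  have := hermitian_posdef_inv_ge0 a pL; rewrite AE ler0c => ?.
  by rewrite ltr_wpDr.
have A0' : 1 + A != 0 by rewrite gt_eqF.
pose c := cgauss_pdf L v / pi.
have c0 : 0 <= c by rewrite divr_ge0 ?cgauss_pdf_ge0// pi_ge0.
have E (x y : R) : scalar_cgauss_pdf (x +i* y) * cgauss_pdf L (v - (x +i* y) *: a) =
    c * (expR (- (1 + A) * x ^+ 2 + 2 * complex.Re b * x) *
         expR (- (1 + A) * y ^+ 2 + 2 * complex.Im b * y)).
  rewrite /scalar_cgauss_pdf {1}/cgauss_pdf Re_hermitian_form_sub// -/b -/A sqr_normcE.
  exact: complete_square_expR.
rewrite ge0_integral_lebesgue_complex; last 2 first.
- apply/measurable_EFinP; apply: measurable_funM.
    exact: measurable_scalar_cgauss_pdf.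
  apply: measurableT_comp (measurable_cgauss_pdf _) _.
  apply: measurable_fun_addmx => //; apply: measurable_fun_oppmx.
  exact: measurable_fun_scalemx.
- by move=> z; rewrite lee_fin mulr_ge0 ?scalar_cgauss_pdf_ge0 ?cgauss_pdf_ge0.
have me (r : R) : measurable_fun setT
    (fun x : R => (expR (- (1 + A) * x ^+ 2 + 2 * r * x))%:E).
  apply/measurable_EFinP; apply: measurableT_comp => //.
  apply: measurable_funD; last exact: measurable_funM.
  by apply: measurable_funM => //; exact: measurable_funX.
transitivity (\int[mu]_x ((c * (Num.sqrt (pi / (1 + A)) *
    expR (complex.Im b ^+ 2 / (1 + A))))%:E *
    (expR (- (1 + A) * x ^+ 2 + 2 * complex.Re b * x))%:E))%E.
  apply: eq_integral => x _.
  transitivity (\int[mu]_y ((c * expR (- (1 + A) * x ^+ 2 + 2 * complex.Re b * x))%:E *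
     (expR (- (1 + A) * y ^+ 2 + 2 * complex.Im b * y))%:E))%E.
    by apply: eq_integral => y _; rewrite E -EFinM mulrA.
  rewrite ge0_integralZl//; last 2 first.
  - exact: (me (complex.Im b)).
  - by rewrite lee_fin mulr_ge0 ?expR_ge0.
  by rewrite integral_expR_quadratic// -!EFinM; congr EFin; ring.
rewrite ge0_integralZl//; last 2 first.
- exact: (me (complex.Re b)).
- by rewrite lee_fin mulr_ge0// mulr_ge0 ?expR_ge0.
rewrite integral_expR_quadratic// -EFinM; congr EFin.
have alE : 1 + (a^t* *m invmx L *m a) 0 0 = (1 + A)%:C by rewrite AE rmorphD rmorph1.
have vKa : (v^t* *m invmx L *m a) 0 0 = b^*%R.
  by rewrite /b ctmx00 !ctmxM trmxCK hK mulmxA.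
(* On the right-hand side the determinant lemma yields the factor [1 + A] of the normalization, and
   Sherman-Morrison the term [|b|^2 / (1 + A)] of the exponent. *)
rewrite /cgauss_pdf det_rank_one_update// invmx_rank_one_update//; last first.
  by rewrite alE (inj_eq (@complexI R) _ 0).
rewrite alE.
have -> : complex.Re (\det L * (1 + A)%:C) = complex.Re (\det L) * (1 + A).
  by case: (\det L) => x y /=; rewrite mulr0 subr0.
have -> : (v^t* *m (invmx L - (1 + A)%:C^-1 *: (invmx L *m a *m (a^t* *m invmx L))) *m v) 0 0
   = (v^t* *m invmx L *m v) 0 0 - (1 + A)^-1%:C * (b^*%R * b).
  rewrite mulmxBr mulmxBl mxE; congr (_ + _).
  rewrite -scalemxAr -scalemxAl mxE mxE -fmorphV; congr (- (_ * _)).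
  have -> : v^t* *m (invmx L *m a *m (a^t* *m invmx L)) *m v =
      (v^t* *m invmx L *m a) *m (a^t* *m invmx L *m v) by rewrite !mulmxA.
  by rewrite mxE big_ord1 vKa.
have -> : complex.Re ((v^t* *m invmx L *m v) 0 0 - (1 + A)^-1%:C * (b^*%R * b)) =
   complex.Re ((v^t* *m invmx L *m v) 0 0) -
     (complex.Re b ^+ 2 + complex.Im b ^+ 2) / (1 + A).
  by case: (_ 0 0) (b) => x y [x' y'] /=; ring.
rewrite opprB expRD [(_ ^+ 2 + _) / _]mulrDl expRD /c /cgauss_pdf.
(* One factor [sq] comes from each of the two real integrals; their product supplies
   [pi / (1 + A)]. *)
set sq := Num.sqrt _.
have sq2 : sq * sq = pi / (1 + A).
  by rewrite -expr2 sqr_sqrtr// divr_ge0 ?pi_ge0 ?ltW.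
set e1 := expR _; set e2 := expR _; set e3 := expR _.
transitivity ((pi ^+ n * complex.Re (\det L))^-1 * e1 / pi * (sq * sq) * (e2 * e3)).
  ring.
have pi0 : pi != 0 :> R by rewrite gt_eqF ?pi_gt0.
have D0 : complex.Re (\det L) != 0 by rewrite gt_eqF ?Re_det_gt0.
rewrite sq2; move: e1 e2 e3 (complex.Re (\det L)) D0 (1 + A) A0' => e1 e2 e3 D D0 B B0.
by move: (@pi R) pi0 => p p0; field; rewrite B0 D0 p0 expf_neq0.
Qed.

End gaussian_integrals.

(** * Gaussian integrals over several complex variables *)

Section gaussian_gram_integrals.
Variable R : realType.
Local Notation C := R[i].
Local Notation mu := (@lebesgue_measure R).
Local Notation muC := (@lebesgue_complex R).
Local Notation normc := ComplexField.Normc.normc.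

Lemma mul_cV_cons n k (A : 'M[C]_(n, 1 + k)) (z : C) (v : 'cV[C]_k) :
  A *m (cV_cons (z, v) : 'cV_(1 + k)) = z *: lsubmx A + rsubmx A *m v.
Proof.
rewrite -[A in LHS]hsubmxK /cV_cons mul_row_col; congr (_ + _).
apply/matrixP => i j; by rewrite !mxE big_ord1 !mxE mulrC !ord1.
Qed.

Lemma mul_ctmx_split n k (A : 'M[C]_(n, 1 + k)) :
  A *m A^t* = lsubmx A *m (lsubmx A)^t* + rsubmx A *m (rsubmx A)^t*.
Proof. by rewrite -{1 2}[A]hsubmxK tr_row_mx map_col_mx mul_row_col. Qed.

Lemma hermitian_posdef_gram n k (L : 'M[C]_n) (A : 'M[C]_(n, k)) :
  hermitian_posdef L -> hermitian_posdef (L + A *m A^t*).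
Proof.
elim: k L A => [|k IH] L A pL.
  by rewrite [A]thinmx0 mul0mx addr0.
rewrite (@mul_ctmx_split n k A) addrA; apply: IH.
exact: hermitian_posdef_rank_one.
Qed.

Lemma integral_cgauss_pdf_gram n k (L : 'M[C]_n) (A : 'M[C]_(n, k)) (v : 'cV[C]_n) :
  hermitian_posdef L ->
  (\int[lebesgue_cV R k]_z (std_cgauss_pdf z * cgauss_pdf L (v - A *m z))%:E =
   (cgauss_pdf (L + A *m A^t*) v)%:E)%E.
Proof.
have mf m (M : 'M[C]_n) (B : 'M[C]_(n, m)) w : measurable_fun setT
    (fun z => (std_cgauss_pdf z * cgauss_pdf M (w - B *m z))%:E).
  apply/measurable_EFinP; apply: measurable_funM.
    exact: measurable_std_cgauss_pdf.
  apply: measurableT_comp (measurable_cgauss_pdf _) _.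
  apply: measurable_fun_addmx => //; apply: measurable_fun_oppmx.
  exact: measurable_fun_mulmx.
have f0 m (M : 'M[C]_n) (B : 'M[C]_(n, m)) w z : hermitian_posdef M ->
    (0 <= (std_cgauss_pdf z * cgauss_pdf M (w - B *m z))%:E)%E.
  by move=> pM; rewrite lee_fin mulr_ge0 ?std_cgauss_pdf_ge0 ?cgauss_pdf_ge0.
elim: k L A v => [|k IH] L A v pL.
  rewrite ge0_integral_lebesgue_cV0; [|exact: mf|by move=> z; exact: f0].
  rewrite [A]thinmx0 !mul0mx addr0 subr0 /std_cgauss_pdf big_ord0 expr0.
  by rewrite oppr0 expR0 invr1 !mul1r.
rewrite ge0_integral_lebesgue_cVS; [|exact: mf|by move=> z; exact: f0].
pose a := lsubmx (A : 'M[C]_(n, 1 + k)); pose B := rsubmx (A : 'M[C]_(n, 1 + k)).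
have -> : L + A *m A^t* = L + B *m B^t* + a *m a^t*.
  by rewrite (@mul_ctmx_split n k A) [X in L + X]addrC addrA.
(* The inner integral treats the columns of [B] at the shifted point [v - z a], by induction; the
   outer one is then a rank-one update of [L + B B^dagger]. *)
have pB : hermitian_posdef (L + B *m B^t* ) by exact: hermitian_posdef_gram.
rewrite -(integral_cgauss_pdf_rank_one a v pB).
apply: eq_integral => z _.
transitivity ((scalar_cgauss_pdf z)%:E * (cgauss_pdf (L + B *m B^t* ) (v - z *: a))%:E)%E; last by [].
rewrite -(IH L B (v - z *: a) pL).
rewrite -(ge0_integralZl (lebesgue_cV R k) measurableT (mf k L B (v - z *: a))); last 2 first.
- by move=> w _; exact: f0.
- by rewrite lee_fin; exact: scalar_cgauss_pdf_ge0.
apply: eq_integral => w _; rewrite -EFinM std_cgauss_pdf_cons -mulrA.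
by rewrite (@mul_cV_cons n k A) opprD addrA.
Qed.

(** Under CN(0, 1) the real and imaginary parts are independent, centered and of variance 1/2. *)
Lemma integral_scalar_cgauss_affine_sqr (a : R) (c : C) :
  (\int[muC]_z ((a + complex.Re (c * z)) ^+ 2 * scalar_cgauss_pdf z)%:E =
  (a ^+ 2 + normc c ^+ 2 / 2)%:E)%E.
Proof.
case: c => p q; rewrite sqr_normcE.
pose g (x : R) := gauss_fun x / Num.sqrt pi.
have g0 x : 0 <= g x by rewrite divr_ge0 ?gauss_fun_ge0.
have mg : measurable_fun setT g.
  by apply: measurable_funM => //; exact: measurable_gauss_fun.
have gE (x y : R) : scalar_cgauss_pdf (x +i* y) = g x * g y.
  rewrite /scalar_cgauss_pdf sqr_normcE /g /gauss_fun opprD expRD.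
  rewrite mulrACA -invfM -[Num.sqrt _ * _]expr2 sqr_sqrtr ?pi_ge0//; ring.
rewrite ge0_integral_lebesgue_complex; last 2 first.
- apply/measurable_EFinP; apply: measurable_funM.
    apply: measurable_funX; apply: measurable_funD => //.
    by apply: measurable_fun_Re; exact: measurable_fun_mulc.
  exact: measurable_scalar_cgauss_pdf.
- by move=> z; rewrite lee_fin mulr_ge0 ?sqr_ge0 ?scalar_cgauss_pdf_ge0.
have mh (b r : R) : measurable_fun setT (fun x : R => ((b + r * x) ^+ 2 * g x)%:E).
  apply/measurable_EFinP; apply: measurable_funM => //; apply: measurable_funX.
  by apply: measurable_funD => //; exact: measurable_funM.
have h0 (b r x : R) : (0 <= ((b + r * x) ^+ 2 * g x)%:E)%E.
  by rewrite lee_fin mulr_ge0// sqr_ge0.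
have m1 : measurable_fun setT (fun x : R => (g x)%:E) by exact/measurable_EFinP.
have gT : (\int[mu]_x (g x)%:E = 1)%E.
  transitivity (\int[mu]_x ((1 + 0 * x) ^+ 2 * g x)%:E)%E.
    by apply: eq_integral => x _; rewrite mul0r addr0 expr1n mul1r.
  by rewrite integral_affine_sqr_gauss expr1n expr0n mul0r addr0.
transitivity (\int[mu]_x (((a + p * x) ^+ 2 * g x)%:E + (q ^+ 2 / 2)%:E * (g x)%:E))%E.
  apply: eq_integral => x _.
  (* The sign is that of [Re ((p + j q) (x + j y)) = p x - q y]. *)
  transitivity (\int[mu]_y ((g x)%:E * (((a + p * x) + - q * y) ^+ 2 * g y)%:E))%E.
    apply: eq_integral => y _; rewrite gE -EFinM /=; congr EFin; ring.
  rewrite ge0_integralZl//; last 2 first.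
  - exact: mh.
  - by rewrite lee_fin.
  rewrite integral_affine_sqr_gauss sqrrN -!EFinM -EFinD; congr EFin; ring.
rewrite ge0_integralD//; last 3 first.
- exact: mh.
- by move=> x _; rewrite mule_ge0 ?lee_fin// mulr_ge0 ?sqr_ge0.
- exact: measurable_funeM.
rewrite ge0_integralZl//; last 2 first.
- by move=> x _; rewrite lee_fin.
- by rewrite lee_fin mulr_ge0 ?sqr_ge0.
rewrite gT mule1 integral_affine_sqr_gauss -EFinD; congr EFin; ring.
Qed.

(* The shift [a] makes the induction on [k] go through. *)
Lemma integral_std_cgauss_affine_sqr k (a : R) (c : 'rV[C]_k) :
  (\int[lebesgue_cV R k]_z ((a + complex.Re ((c *m z) 0 0)) ^+ 2 * std_cgauss_pdf z)%:E =
  (a ^+ 2 + (\sum_(i < k) normc (c 0 i) ^+ 2) / 2)%:E)%E.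
Proof.
have mf m b (e : 'rV[C]_m) : measurable_fun setT
    (fun z => ((b + complex.Re ((e *m z) 0 0)) ^+ 2 * std_cgauss_pdf z)%:E).
  apply/measurable_EFinP; apply: measurable_funM; last exact: measurable_std_cgauss_pdf.
  apply: measurable_funX; apply: measurable_funD => //.
  apply: measurable_fun_Re; apply: measurable_fun_entry.
  exact: measurable_fun_mulmx.
have f0 m b (e : 'rV[C]_m) z :
    (0 <= ((b + complex.Re ((e *m z) 0 0)) ^+ 2 * std_cgauss_pdf z)%:E)%E.
  by rewrite lee_fin mulr_ge0 ?sqr_ge0 ?std_cgauss_pdf_ge0.
elim: k a c => [|k IH] a c.
  rewrite ge0_integral_lebesgue_cV0; [|exact: mf|exact: f0].
  rewrite mulmx0 mxE /= addr0 /std_cgauss_pdf !big_ord0 expr0 invr1 oppr0 expR0.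
  by rewrite mul0r addr0 !mulr1.
rewrite ge0_integral_lebesgue_cVS; [|exact: mf|exact: f0].
pose c0 := c 0 ord0; pose c' := rsubmx (c : 'rV[C]_(1 + k)).
set S := (\sum_(i < k) normc (c' 0 i) ^+ 2) / 2.
have S0 : 0 <= S by rewrite divr_ge0// sumr_ge0// => i _; rewrite sqr_ge0.
have -> : \sum_(i < k.+1) normc (c 0 i) ^+ 2 = normc c0 ^+ 2 + \sum_(i < k) normc (c' 0 i) ^+ 2.
  rewrite big_ord_recl; congr (_ + _); apply: eq_bigr => i _.
  by rewrite mxE; congr (normc (c _ _) ^+ 2); exact: val_inj.
(* The second summand is [S] times the density; the trivial factor [(1 + Re (0 z))^2] lets the
   one-variable lemma integrate it too. *)
transitivity (\int[muC]_z (((a + complex.Re (c0 * z)) ^+ 2 * scalar_cgauss_pdf z)%:E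
   + S%:E * ((1 + complex.Re (0 * z)) ^+ 2 * scalar_cgauss_pdf z)%:E))%E.
  apply: eq_integral => z _.
  transitivity (\int[lebesgue_cV R k]_w ((scalar_cgauss_pdf z)%:E *
     ((a + complex.Re (c0 * z) + complex.Re ((c' *m w) 0 0)) ^+ 2 * std_cgauss_pdf w)%:E))%E.
    apply: eq_integral => w _; rewrite -EFinM std_cgauss_pdf_cons.
    rewrite (@mul_cV_cons 1 k c) mxE raddfD -/c' addrA.
    have -> : (z *: lsubmx (c : 'rV[C]_(1 + k))) 0 0 = c0 * z.
      by rewrite mxE mxE mulrC; congr (c _ _ * _); exact: val_inj.
    by congr EFin; ring.
  rewrite (ge0_integralZl (lebesgue_cV R k) measurableT (mf k (a + complex.Re (c0 * z)) c')); last 2 first.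
  - by move=> w _; exact: f0.
  - by rewrite lee_fin; exact: scalar_cgauss_pdf_ge0.
  rewrite IH -!EFinM -EFinD; congr EFin; rewrite mul0r /= addr0 -/S; ring.
have ms (b : R) (e : C) : measurable_fun setT
    (fun z => ((b + complex.Re (e * z)) ^+ 2 * scalar_cgauss_pdf z)%:E).
  apply/measurable_EFinP; apply: measurable_funM; last exact: measurable_scalar_cgauss_pdf.
  apply: measurable_funX; apply: measurable_funD => //.
  by apply: measurable_fun_Re; exact: measurable_fun_mulc.
have s0 (b : R) (e : C) z :
    (0 <= ((b + complex.Re (e * z)) ^+ 2 * scalar_cgauss_pdf z)%:E)%E.
  by rewrite lee_fin mulr_ge0 ?sqr_ge0 ?scalar_cgauss_pdf_ge0.
rewrite ge0_integralD; [|by []|by move=> z _; exact: s0|exact: ms| |]; last 2 first.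
- by move=> z _; apply: mule_ge0; [rewrite lee_fin|exact: s0].
- by apply: measurable_funeM; exact: ms.
rewrite ge0_integralZl; [|by []|exact: ms|by move=> z _; exact: s0|by rewrite lee_fin].
rewrite !integral_scalar_cgauss_affine_sqr -EFinM -EFinD; congr EFin.
rewrite sqr_normcE /S; ring.
Qed.

End gaussian_gram_integrals.

(** * Laws given by densities and their moments *)

Section density_change_of_variables.
Context d1 d2 (X : measurableType d1) (Y : measurableType d2) (R : realType).
Variables (mu : {measure set X -> \bar R}) (nu : {measure set Y -> \bar R}).
Variables (phi : X -> Y) (g : X -> R).
Hypotheses (mphi : measurable_fun setT phi) (mg : measurable_fun setT g).
Hypothesis g0 : forall x, 0 <= g x.
Hypothesis nuE : forall B, measurable B ->
  nu B = (\int[mu]_(x in phi @^-1` B) (g x)%:E)%E.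

Import HBNNSimple.
Local Open Scope ereal_scope.

Let density_indic (E : set Y) : measurable E ->
  \int[nu]_y (\1_E y)%:E = \int[mu]_x ((\1_E (phi x))%:E * (g x)%:E).
Proof.
move=> mE; rewrite integral_indic// setIT nuE// integral_mkcond.
apply: eq_integral => x _; rewrite patchE indicE.
have -> : (x \in phi @^-1` E) = (phi x \in E) by apply/idP/idP; rewrite !inE.
by case: ifP => _; rewrite ?mul1e ?mul0e.
Qed.

Let density_nnsfun (f : {nnsfun Y >-> R}) :
  \int[nu]_y (f y)%:E = \int[mu]_x ((f (phi x))%:E * (g x)%:E).
Proof.
have mi r : measurable_fun setT (fun x => (\1_(f @^-1` [set r]) (phi x))%:E * (g x)%:E).
  apply: emeasurable_funM; apply/measurable_EFinP => //.
  by apply: measurableT_comp mphi.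
under [LHS]eq_integral do rewrite fimfunE -fsumEFin//.
rewrite [LHS]ge0_integral_fsum//; last 2 first.
  - by move=> r; exact/measurable_EFinP/measurableT_comp.
  - by move=> n x _; rewrite EFinM nnfun_muleindic_ge0.
under [RHS]eq_integral.
  move=> x xD; rewrite fimfunE -fsumEFin// ge0_mule_fsuml; last first.
    by move=> r; rewrite EFinM nnfun_muleindic_ge0.
  over.
rewrite [RHS]ge0_integral_fsum//; last 2 first.
  - move=> r; under eq_fun do rewrite EFinM -muleA.
    by apply: measurable_funeM; exact: mi.
  - move=> n x _; rewrite mule_ge0//; last by rewrite lee_fin.
    by rewrite EFinM nnfun_muleindic_ge0.
apply: eq_fsbigr => r; rewrite inE => -[y _ fyr].
have r0 : (0 <= r)%R by rewrite -fyr.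
under [RHS]eq_integral do rewrite EFinM -muleA.
rewrite integralZl_indic_nnsfun// [RHS]ge0_integralZl//.
- by congr (_ * _); exact: density_indic.
- by move=> x _; rewrite mule_ge0// lee_fin.
Qed.

(** Passes from indicators to simple functions to monotone limits. With [phi] the identity it
    handles a law with a density; with [phi] affine it handles a possibly degenerate Gaussian
    law. *)
Lemma ge0_integral_density (f : Y -> \bar R) :
  measurable_fun setT f -> (forall y, 0 <= f y) ->
  \int[nu]_y f y = \int[mu]_x (f (phi x) * (g x)%:E).
Proof.
move=> mf f0.
pose f_ := nnsfun_approx measurableT mf.
transitivity (limn (fun n => \int[nu]_y (f_ n y)%:E)).
  rewrite -monotone_convergence//=.
  - apply: eq_integral => ? /[!inE] xD; apply/esym/cvg_lim => //=.
    exact: cvg_nnsfun_approx.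
  - by move=> n; exact/measurable_EFinP/measurable_funTS.
  - by move=> n ? _; rewrite lee_fin.
  - by move=> ? _ ? ? mn; rewrite lee_fin; exact/lefP/nd_nnsfun_approx.
transitivity (limn (fun n => \int[mu]_x ((f_ n (phi x))%:E * (g x)%:E))).
  by apply: congr_lim; apply/funext => n; exact: density_nnsfun.
rewrite -monotone_convergence//=.
- apply: eq_integral => x _; apply/cvg_lim => //=.
  apply: cvgeZr => //; exact: cvg_nnsfun_approx.
- move=> n; apply: emeasurable_funM; apply/measurable_EFinP => //.
  by apply: measurableT_comp mphi.
- by move=> n x _; rewrite mule_ge0// lee_fin.
- move=> x _ m n mn; rewrite lee_wpmul2r// lee_fin//.
  exact/lefP/nd_nnsfun_approx.
Qed.

End density_change_of_variables.

Lemma add_entry (V : zmodType) m n (A B : 'M[V]_(m, n)) i j :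
  (A + B) i j = A i j + B i j.
Proof. by rewrite mxE. Qed.

Lemma sub_entry (V : zmodType) m n (A B : 'M[V]_(m, n)) i j :
  (A - B) i j = A i j - B i j.
Proof. by rewrite mxE mxE. Qed.

Lemma ReD (R : realType) (x y : R[i]) :
  complex.Re (x + y) = complex.Re x + complex.Re y.
Proof. by rewrite raddfD. Qed.

Lemma ReB (R : realType) (x y : R[i]) :
  complex.Re (x - y) = complex.Re x - complex.Re y.
Proof. by rewrite raddfB. Qed.

Section integral_of_finite_ge0.
Context d (X : measurableType d) (R : realType) (P : {measure set X -> \bar R}).

Lemma integrable_of_ge0_fin (f : X -> R) (r : R) :
  measurable_fun setT f -> (forall x, 0 <= f x) ->
  (\int[P]_x (f x)%:E = r%:E)%E ->
  P.-integrable setT (EFin \o f) /\ \int[P]_(x in setT) f x = r.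
Proof.
move=> mf f0 fr; split; last by rewrite /Rintegral fr.
apply/integrableP; split; first exact/measurable_EFinP.
under eq_integral do rewrite /= ger0_norm//.
by rewrite fr ltry.
Qed.

(* Polarization: the product is a quarter of the difference of two squares. *)
Lemma Rintegral_polarization (f g : X -> R) (r1 r2 : R) :
  measurable_fun setT f -> measurable_fun setT g ->
  (\int[P]_x ((f x + g x) ^+ 2)%:E = r1%:E)%E ->
  (\int[P]_x ((f x - g x) ^+ 2)%:E = r2%:E)%E ->
  P.-integrable setT (fun x => (f x * g x)%:E) /\
  \int[P]_(x in setT) (f x * g x) = (r1 - r2) / 4.
Proof.
move=> mf mg E1 E2.
have [i1 {}E1] := integrable_of_ge0_fin (measurable_funX 2 (measurable_funD mf mg))
  (fun x => sqr_ge0 _) E1.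
have [i2 {}E2] := integrable_of_ge0_fin (measurable_funX 2 (measurable_funB mf mg))
  (fun x => sqr_ge0 _) E2.
have fgE x : f x * g x = 4^-1 * (((f x + g x) ^+ 2) - (f x - g x) ^+ 2) by field.
have i3 : P.-integrable setT (EFin \o (fun x => (f x + g x) ^+ 2 - (f x - g x) ^+ 2)).
  exact: (integrableB measurableT i1 i2).
split.
  under eq_fun do rewrite fgE EFinM.
  exact: (integrableZl measurableT 4^-1 i3).
under eq_Rintegral do rewrite fgE.
rewrite RintegralZl// RintegralB//.
rewrite mulrC; congr (_ * _); congr (_ - _); [exact: E1|exact: E2].
Qed.

End integral_of_finite_ge0.

Lemma measurable_affine_cV (R : realType) n k (b : 'cV[R[i]]_n)
    (B : 'M[R[i]]_(n, k)) : measurable_fun setT (fun z => b + B *m z).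
Proof. by apply: measurable_fun_addmx => //; exact: measurable_fun_mulmx. Qed.

(** * First and second moments of a circular Gaussian vector *)

Section circular_gaussian_moments.
Context (R : realType) (d : measure_display) (Omega : measurableType d)
  (P : probability Omega R).
Variables (n k : nat) (h : Omega -> 'cV[R[i]]_n) (m : 'cV[R[i]]_n)
  (A : 'M[R[i]]_(n, k)).
Local Notation C := R[i].
Local Notation normc := ComplexField.Normc.normc.
Hypothesis mh : measurable_fun setT h.
Hypothesis hE : forall B : set 'cV[R[i]]_n, measurable B ->
  P (h @^-1` B) = (\int[lebesgue_cV R k]_(z in [set z | B (m + A *m z)%R])
                         (std_cgauss_pdf z)%:E)%E.

Lemma ge0_integral_circular_gaussian (f : 'cV[C]_n -> \bar R) :
  measurable_fun setT f -> (forall y, 0 <= f y)%E ->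
  (\int[P]_w f (h w) =
   \int[lebesgue_cV R k]_z (f (m + A *m z)%R * (std_cgauss_pdf z)%:E))%E.
Proof.
move=> mf f0.
have := @ge0_integral_pushforward _ _ _ _ _ _ mh P setT f measurableT mf.
rewrite preimage_setT => <-//.
pose nu := measure_function_pushforward__canonical__measure_function_Measure P mh.
apply: (@ge0_integral_density _ _ _ _ _ (lebesgue_cV R k) nu
  (fun z => m + A *m z) (@std_cgauss_pdf R k)) => //.
- exact: measurable_affine_cV.
- exact: measurable_std_cgauss_pdf.
- exact: std_cgauss_pdf_ge0.
Qed.

Let X (c : 'rV[C]_n) (w : Omega) : R := complex.Re ((c *m h w) 0 0).

Let mX c : measurable_fun setT (X c).
Proof.
apply: measurable_fun_Re; apply: measurable_fun_entry.
exact: measurable_fun_mulmx.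
Qed.

(** The variance of [X c]. *)
Let S (c : 'rV[C]_n) : R := (\sum_(i < k) normc ((c *m A) 0 i) ^+ 2) / 2.

Lemma integral_circular_gaussian_affine_sqr (a : R) (c : 'rV[C]_n) :
  (\int[P]_w ((a + X c w) ^+ 2)%:E =
   ((a + complex.Re ((c *m m) 0 0)) ^+ 2 + S c)%:E)%E.
Proof.
rewrite (@ge0_integral_circular_gaussian
  (fun y => ((a + complex.Re ((c *m y) 0 0)) ^+ 2)%:E)); last 2 first.
- apply/measurable_EFinP; apply: measurable_funX; apply: measurable_funD => //.
  apply: measurable_fun_Re; apply: measurable_fun_entry.
  exact: measurable_fun_mulmx.
- by move=> y; rewrite lee_fin sqr_ge0.
rewrite -integral_std_cgauss_affine_sqr; apply: eq_integral => z _.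
by rewrite -EFinM mulmxDr add_entry ReD addrA mulmxA.
Qed.

(** Polarization against the constant 1: [X = ((X + 1)^2 - (X - 1)^2) / 4] expresses the mean by
    integrals of squares. *)
Lemma Rintegral_circular_gaussian_Re (c : 'rV[C]_n) :
  \int[P]_(w in setT) X c w = complex.Re ((c *m m) 0 0).
Proof.
have E1 : (\int[P]_w ((X c w + cst 1 w) ^+ 2)%:E =
    ((1 + complex.Re ((c *m m) 0 0)) ^+ 2 + S c)%:E)%E.
  rewrite -integral_circular_gaussian_affine_sqr.
  by apply: eq_integral => w _; rewrite /= addrC.
have E2 : (\int[P]_w ((X c w - cst 1 w) ^+ 2)%:E =
    ((- 1 + complex.Re ((c *m m) 0 0)) ^+ 2 + S c)%:E)%E.
  rewrite -integral_circular_gaussian_affine_sqr.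
  by apply: eq_integral => w _; rewrite /= addrC.
have m1 : measurable_fun setT (cst 1 : Omega -> R) by exact: measurable_cst.
have [_ E] := Rintegral_polarization (mX c) m1 E1 E2.
transitivity (\int[P]_(w in setT) (X c w * cst 1 w)).
  by apply: eq_Rintegral => w _; rewrite mulr1.
by rewrite E; field.
Qed.

(** Polarization of the variance [S]. Integrability is part of the conclusion because such products
    are later added and subtracted under the integral. *)
Lemma Rintegral_circular_gaussian_cov (c e : 'rV[C]_n) :
  let u (w : Omega) := h w - m in
  P.-integrable setT (fun w => (complex.Re ((c *m u w) 0 0) *
    complex.Re ((e *m u w) 0 0))%:E) /\
  \int[P]_(w in setT) (complex.Re ((c *m u w) 0 0) * complex.Re ((e *m u w) 0 0))
  = complex.Re ((c *m (A *m A^t*) *m e^t*) 0 0) / 2.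
Proof.
move=> u.
have mu : measurable_fun setT u.
  by apply: measurable_fun_addmx => //; exact: measurable_cst.
have mY (b : 'rV[C]_n) : measurable_fun setT (fun w => complex.Re ((b *m u w) 0 0)).
  by apply: measurable_fun_Re; apply: measurable_fun_entry; exact: measurable_fun_mulmx.
have YE b : (\int[P]_w (complex.Re ((b *m u w) 0 0) ^+ 2)%:E = (S b)%:E)%E.
  (* With minus the mean as the shift, only the variance remains. *)
  transitivity (\int[P]_w ((- complex.Re ((b *m m) 0 0) + X b w) ^+ 2)%:E)%E.
    apply: eq_integral => w _; rewrite /u mulmxBr sub_entry ReB addrC.
    by [].
  by rewrite integral_circular_gaussian_affine_sqr addNr expr0n add0r.
have E1 : (\int[P]_w ((complex.Re ((c *m u w) 0 0) +
    complex.Re ((e *m u w) 0 0)) ^+ 2)%:E = (S (c + e))%:E)%E.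
  by rewrite -YE; apply: eq_integral => w _; rewrite mulmxDl add_entry ReD.
have E2 : (\int[P]_w ((complex.Re ((c *m u w) 0 0) -
    complex.Re ((e *m u w) 0 0)) ^+ 2)%:E = (S (c - e))%:E)%E.
  by rewrite -YE; apply: eq_integral => w _; rewrite mulmxBl sub_entry ReB.
have [i ->] := Rintegral_polarization (mY c) (mY e) E1 E2.
split => //.
have -> : (c *m (A *m A^t*) *m e^t*) 0 0 =
    \sum_(l < k) (c *m A) 0 l * ((e *m A) 0 l)^*%R.
  have -> : c *m (A *m A^t*) *m e^t* = (c *m A) *m (e *m A)^t*.
    by rewrite ctmxM !mulmxA.
  rewrite mxE; apply: eq_bigr => l _.
  by congr (_ * _); rewrite !mxE.
rewrite raddf_sum /S -mulrBl -sumrB !mulr_suml.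
apply: eq_bigr => l _; rewrite mulmxDl mulmxBl add_entry sub_entry.
move: ((c *m A)%R 0 l) ((e *m A)%R 0 l).
by move=> [p q] [r t]; rewrite !sqr_normcE /=; field.
Qed.

End circular_gaussian_moments.

Section circular_gaussian_parameters.
Context (R : realType) (d : measure_display) (Omega : measurableType d)
  (P : probability Omega R).
Variables (n k : nat) (h : Omega -> 'cV[R[i]]_n) (m : 'cV[R[i]]_n)
  (A : 'M[R[i]]_(n, k)).
Local Notation C := R[i].
Hypothesis mh : measurable_fun setT h.
Hypothesis hE : forall B : set 'cV[R[i]]_n, measurable B ->
  P (h @^-1` B) = (\int[lebesgue_cV R k]_(z in [set z | B (m + A *m z)%R])
                         (std_cgauss_pdf z)%:E)%E.

Lemma scale_delta_mulmx (z : C) (v : 'cV[C]_n) i :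
  ((z *: delta_mx 0 i : 'rV[C]_n) *m v) 0 0 = z * v i 0.
Proof. by rewrite -scalemxAl mxE -rowE mxE. Qed.

(** Rotating a row vector by [-j] turns the results on real parts into results on imaginary
    parts. *)
Lemma Re_mulNi (z : C) : complex.Re ((0 -i* 1) * z) = complex.Im z.
Proof. by case: z => x y /=; rewrite mul0r mulN1r sub0r opprK. Qed.

Lemma cexpectation_circular_gaussian i :
  cexpectation P (fun omega => h omega i 0) = m i 0.
Proof.
pose e (z : C) : 'rV[C]_n := z *: delta_mx 0 i.
have E z := Rintegral_circular_gaussian_Re mh hE (e z).
rewrite /cexpectation.
have -> : \int[P]_(w in setT) complex.Re (h w i 0) = complex.Re (m i 0).
  transitivity (\int[P]_(w in setT) complex.Re ((e 1 *m h w) 0 0)).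
    by apply: eq_Rintegral => w _; rewrite scale_delta_mulmx mul1r.
  by rewrite E scale_delta_mulmx mul1r.
have -> : \int[P]_(w in setT) complex.Im (h w i 0) = complex.Im (m i 0).
  transitivity (\int[P]_(w in setT)
      complex.Re ((e (0 -i* 1) *m h w) 0 0)).
    by apply: eq_Rintegral => w _; rewrite scale_delta_mulmx Re_mulNi.
  by rewrite E scale_delta_mulmx Re_mulNi.
by case: (m i 0).
Qed.

Lemma cexpectation_circular_gaussian_cov i j :
  cexpectation P (fun omega => ((h omega - m) *m (h omega - m)^t* ) i j)
  = (A *m A^t* ) i j.
Proof.
pose e (z : C) l : 'rV[C]_n := z *: delta_mx 0 l.
have E z1 z2 := Rintegral_circular_gaussian_cov mh hE (e z1 i) (e z2 j).
have GE z1 z2 : (e z1 i *m (A *m A^t* ) *m (e z2 j)^t* ) 0 0 =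
    z1 * z2^*%R * (A *m A^t* ) i j.
  move: (A *m A^t* ) => G.
  have -> : (e z2 j)^t* = z2^*%R *: delta_mx j 0.
    rewrite ctmxZ; congr (_ *: _); apply/matrixP => a b; rewrite !mxE.
    by rewrite andbC; case: (_ && _); [exact: conjc1|exact: conjc0].
  by rewrite -scalemxAr mxE -colE mxE /e -scalemxAl mxE -rowE mxE; ring.
pose u w := h w - m.
have uE w : ((h w - m) *m (h w - m)^t* ) i j = u w i 0 * (u w j 0)^*%R.
  by rewrite mxE big_ord1 /u; move: (h w - m) => v; rewrite !mxE.
have XE z1 z2 : \int[P]_(w in setT) (complex.Re (z1 * u w i 0) * complex.Re (z2 * u w j 0))
    = complex.Re (z1 * z2^*%R * (A *m A^t* ) i j) / 2 /\
    P.-integrable setT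
      (fun w => (complex.Re (z1 * u w i 0) * complex.Re (z2 * u w j 0))%:E).
  have [i1 i2] := E z1 z2; rewrite GE in i2; split.
    rewrite -i2; apply: eq_Rintegral => w _; rewrite /e !scale_delta_mulmx.
    by [].
  by under eq_fun do rewrite -!scale_delta_mulmx.
(* The real part of [u_i conj(u_j)] is [Re Re + Im Im] and its imaginary part [Im Re - Re Im]: four
   real covariances, one for each choice of the multipliers in {1, -j}. *)
have [e11 i11] := XE 1 1; have [eii iii] := XE (0 -i* 1) (0 -i* 1).
have [ei1 ii1] := XE (0 -i* 1) 1; have [e1i i1i] := XE 1 (0 -i* 1).
rewrite /cexpectation.
have -> : \int[P]_(w in setT) complex.Re (((h w - m) *m (h w - m)^t* ) i j)
    = complex.Re ((A *m A^t* ) i j).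
  transitivity (\int[P]_(w in setT) (complex.Re (1 * u w i 0) * complex.Re (1 * u w j 0)
     + complex.Re ((0 -i* 1) * u w i 0) * complex.Re ((0 -i* 1) * u w j 0))).
    apply: eq_Rintegral => w _; rewrite uE !Re_mulNi !mul1r.
    by case: (u w i 0) (u w j 0) => x y [x' y'] /=; ring.
  rewrite RintegralD// e11 eii.
  by move: (fun_of_matrix (A *m A^t* ) i j) => [x y] /=; field.
have -> : \int[P]_(w in setT) complex.Im (((h w - m) *m (h w - m)^t* ) i j)
    = complex.Im ((A *m A^t* ) i j).
  transitivity (\int[P]_(w in setT) (complex.Re ((0 -i* 1) * u w i 0) * complex.Re (1 * u w j 0)
     - complex.Re (1 * u w i 0) * complex.Re ((0 -i* 1) * u w j 0))).
    apply: eq_Rintegral => w _; rewrite uE !Re_mulNi !mul1r.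
    by case: (u w i 0) (u w j 0) => x y [x' y'] /=; ring.
  rewrite RintegralB// ei1 e1i.
  by move: (fun_of_matrix (A *m A^t* ) i j) => [x y] /=; field.
by case: ((A *m A^t* ) i j).
Qed.

End circular_gaussian_parameters.

(** * Independence *)

Section independence.
Context (R : realType) (d : measure_display) (Omega : measurableType d)
  (P : probability Omega R) d1 d2 d3 (T1 : measurableType d1)
  (T2 : measurableType d2) (T3 : measurableType d3).
Variables (X : {RV P >-> T1}) (Y : {RV P >-> T2}) (Z : {RV P >-> T3}).
Hypothesis indep : mutually_independent3 P X Y Z.
Local Open Scope ereal_scope.

Let XY (w : Omega) := (X w, Y w).
Let mXY : measurable_fun setT XY. Proof. exact: measurable_fun_pair. Qed.

(** For fixed [B], the law of [(X, Y)] restricted to the event [Z in B] and divided by its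
    probability agrees with the product measure on rectangles, hence everywhere. A null event is
    treated apart because of the division. *)
Lemma independent_joint_rectangle (E : set (T1 * T2)) (B : set T3) :
  measurable E -> measurable B ->
  P (XY @^-1` E `&` Z @^-1` B) = (distribution P X \x distribution P Y) E * P (Z @^-1` B).
Proof.
move=> mE mB.
have mZB : measurable (Z @^-1` B) by rewrite -[X in measurable X]setTI; exact: measurable_funP.
have mXYE : measurable (XY @^-1` E) by rewrite -[X in measurable X]setTI; exact: mXY.
have fr : P (Z @^-1` B) \is a fin_num by exact: fin_num_measure.
have [r0|r0] := eqVneq (P (Z @^-1` B)) 0.
  rewrite r0 mule0; apply/eqP; rewrite eq_le measure_ge0 andbT -r0.
  by apply: le_measure; rewrite ?inE//; exact: measurableI.
pose r : R := fine (P (Z @^-1` B)).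
have rE : P (Z @^-1` B) = r%:E by rewrite fineK.
have rgt0 : (0 < r)%R by rewrite fine_gt0// lt0e r0 measure_ge0/= -ge0_fin_numE.
have ri0 : (0 <= r^-1)%R by rewrite invr_ge0 ltW.
pose nu := mscale (NngNum ri0)
  (measure_function_pushforward__canonical__measure_function_Measure (mrestr P mZB) mXY).
have := @product_measure_unique _ _ _ _ _ (distribution P X) (distribution P Y) nu.
move=> -> //.
  rewrite /nu /mscale /= /pushforward /mrestr rE muleAC -EFinM mulVf ?gt_eqF// mul1e.
  by [].
move=> A A' mA mA'.
change (r^-1%:E * P (X @^-1` A `&` Y @^-1` A' `&` Z @^-1` B) =
  P (X @^-1` A) * P (Y @^-1` A')).
by rewrite indep// rE muleC -muleA -EFinM mulfV ?gt_eqF// mule1.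
Qed.

(** The third variable, which will be the phase, is outermost, so that the two inner integrals are
    computed at a fixed phase. *)
Lemma integral_independent3 (F : (T1 * T2) * T3 -> \bar R) :
  measurable_fun setT F -> (forall p, 0 <= F p) ->
  \int[P]_w F ((X w, Y w), Z w) =
  \int[distribution P Z]_z \int[distribution P X]_x \int[distribution P Y]_y
    F ((x, y), z).
Proof.
move=> mF F0.
have mXYZ : measurable_fun setT (fun w => (XY w, Z w)) by exact: measurable_fun_pair.
have := @ge0_integral_pushforward _ _ _ _ _ _ mXYZ P setT F measurableT mF.
rewrite preimage_setT /= => <-//.
pose nu := measure_function_pushforward__canonical__measure_function_Measure P mXYZ.
pose p1 : probability T1 R := distribution P X.
pose p2 : probability T2 R := distribution P Y.
pose m12 : probability (T1 * T2)%type R := p1 \x p2.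
have key E : measurable E -> (m12 \x distribution P Z) E = nu E.
  apply: (@product_measure_unique _ _ _ _ _ m12 (distribution P Z) nu) => A B mA mB.
  exact: independent_joint_rectangle.
transitivity (\int[m12 \x distribution P Z]_p F p).
  apply: eq_measure_integral => E mE _. exact: (esym (key E mE)).
rewrite fubini_tonelli2//; apply: eq_integral => z _; rewrite /fubini_G.
rewrite fubini_tonelli1//.
by apply: measurableT_comp mF _; exact: measurable_fun_pair.
Qed.

End independence.

(** * The phase integral *)

Section phase_integral.
Variable R : realType.
Local Notation mu := (@lebesgue_measure R).
Local Notation normc := ComplexField.Normc.normc.

Lemma ge0_integral_shift_itv (f : R -> \bar R) (c a b : R) (b0 b1 : bool) :
  measurable_fun setT f -> (forall x, 0 <= f x)%E ->
  (\int[mu]_(x in [set` Interval (BSide b0 a) (BSide b1 b)]) f (x + c)%R =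
   \int[mu]_(x in [set` Interval (BSide b0 (a + c)%R) (BSide b1 (b + c)%R)]) f x)%E.
Proof.
move=> mf f0; rewrite integral_mkcond [RHS]integral_mkcond.
rewrite -[RHS](ge0_integral_shift c).
- apply: eq_integral => x _; rewrite !patchE !mem_setE.
  by case: b0 b1 => -[]; rewrite !in_itv/= ?lerD2r ?ltrD2r.
- exact: (proj1 (measurable_restrictT f (measurable_itv _)) (measurable_funTS mf)).
- by move=> x; rewrite patchE; case: ifP.
Qed.

(** The shifted interval is [[-pi - phi, pi - phi]]. Its part to the left of [-pi] is moved by one
    period and fills the gap from [pi - phi] to [pi]; the bounds on [phi] keep these pieces in
    order. *)
Lemma integral_expR_cos_shift (r phi : R) : 0 <= phi <= 2 * pi ->
  (\int[mu]_(t in `[(- pi)%R, pi]) (expR (r * cos (t - phi)))%:E =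
   \int[mu]_(t in `[(- pi)%R, pi]) (expR (r * cos t))%:E)%E.
Proof.
move=> /andP[phi0 phi2].
pose F t : \bar R := (expR (r * cos t))%:E.
have mF : measurable_fun setT F.
  apply/measurable_EFinP; apply: measurableT_comp => //; apply: measurable_funM => //.
  by apply: continuous_measurable_fun; exact: continuous_cos.
have F0 t : (0 <= F t)%E by rewrite lee_fin expR_ge0.
have Fper t : F (t + 2 * pi) = F t.
  by rewrite /F mulr_natl cosD2pi.
rewrite (@ge0_integral_shift_itv F (- phi) (- pi) pi true false)//.
transitivity (\int[mu]_(x in `[(- pi - phi)%R, (- pi)%R[) F x +
   \int[mu]_(x in `[(- pi)%R, (pi - phi)%R]) F x)%E.
  rewrite -ge0_integral_setU//.
  - by rewrite -itv_bndbnd_setU// bnd_simp; lra.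
  - exact: measurable_funTS.
  - apply/disj_setPS => x [] /=; rewrite !in_itv/= => /andP[_ h1] /andP[h2 _].
    by move: (lt_le_trans h1 h2); rewrite ltxx.
have -> : (\int[mu]_(x in `[(- pi - phi)%R, (- pi)%R[) F x =
   \int[mu]_(x in `[(pi - phi)%R, pi[) F x)%E.
  have e1 : - pi - phi + 2 * pi = pi - phi by ring.
  have e2 : - pi + 2 * pi = pi :> R by ring.
  have := ge0_integral_shift_itv (2 * pi) (- pi - phi) (- pi) true true mF F0.
  by rewrite e1 e2 => <-; apply: eq_integral => x _; rewrite Fper.
rewrite addeC -integral_itv_bndo_bndc; last exact: measurable_funTS.
rewrite -ge0_integral_setU//.
- rewrite -itv_bndbnd_setU ?bnd_simp; [|lra|lra].
  by rewrite integral_itv_bndo_bndc//; exact: measurable_funTS.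
- exact: measurable_funTS.
- apply/disj_setPS => x [] /=; rewrite !in_itv/= => /andP[_ h1] /andP[h2 _].
  by move: (lt_le_trans h1 h2); rewrite ltxx.
Qed.

Lemma integral_expR_cos_even (r : R) :
  (\int[mu]_(t in `[(- pi)%R, pi]) (expR (r * cos t))%:E =
   2%:E * \int[mu]_(t in `[0%R, pi]) (expR (r * cos t))%:E)%E.
Proof.
pose F t : \bar R := (expR (r * cos t))%:E.
have mF : measurable_fun setT F.
  apply/measurable_EFinP; apply: measurableT_comp => //; apply: measurable_funM => //.
  by apply: continuous_measurable_fun; exact: continuous_cos.
have F0 t : (0 <= F t)%E by rewrite lee_fin expR_ge0.
have pi0 : 0 <= pi :> R by exact: pi_ge0.
transitivity (\int[mu]_(x in `[(- pi)%R, 0%R[) F x + \int[mu]_(x in `[0%R, pi]) F x)%E.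
  rewrite -ge0_integral_setU//.
  - by rewrite -itv_bndbnd_setU// bnd_simp; lra.
  - exact: measurable_funTS.
  - apply/disj_setPS => x [] /=; rewrite !in_itv/= => /andP[_ h1] /andP[h2 _].
    by move: (lt_le_trans h1 h2); rewrite ltxx.
rewrite mule_natl mule2n; congr (_ + _)%E.
rewrite integral_itv_bndo_bndc; last exact: measurable_funTS.
rewrite integral_mkcond [RHS]integral_mkcond -[LHS]ge0_integral_opp.
- apply: eq_integral => x _; rewrite !patchE /F cosN.
  rewrite !mem_setE !in_itv/= lerN2 oppr_le0 andbC.
  by [].
- exact: (proj1 (measurable_restrictT F (measurable_itv _)) (measurable_funTS mF)).
- by move=> x; rewrite patchE; case: ifP.
Qed.

Lemma polar_angle (p q : R) : exists2 phi, 0 <= phi <= 2 * pi &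
  p = normc (p +i* q) * cos phi /\ q = normc (p +i* q) * sin phi.
Proof.
rewrite /=; set r := Num.sqrt _.
have r2 : r ^+ 2 = p ^+ 2 + q ^+ 2 by rewrite sqr_sqrtr// addr_ge0 ?sqr_ge0.
have pi0 : 0 <= pi :> R by exact: pi_ge0.
have [r0|r0] := eqVneq r 0.
  exists 0; first by rewrite lexx/= mulr_ge0.
  move: r2; rewrite r0 expr0n /= => /esym/eqP.
  by rewrite paddr_eq0 ?sqr_ge0// !sqrf_eq0 !mul0r => /andP[/eqP -> /eqP ->].
have rp : 0 < r by rewrite lt0r r0 sqrtr_ge0.
have px : (p / r) ^+ 2 + (q / r) ^+ 2 = 1.
  by rewrite !exprMn -mulrDl -r2 -exprMn mulfV// expr1n.
have p1 : -1 <= p / r <= 1.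
  rewrite -ler_norml -(@ler_pXn2r _ 2)// ?nnegrE// expr1n -normrX ger0_norm ?sqr_ge0//.
  by rewrite -px lerDl sqr_ge0.
have sE : Num.sqrt (1 - (p / r) ^+ 2) = `|q| / r.
  by rewrite -px addrC addKr sqrtr_sqr normrM (gtr0_norm (x := r^-1)) ?invr_gt0.
have a0 := acos_ge0 p1; have api := acos_lepi p1.
(* [acos] has values in [[0, pi]], where [sin] is nonnegative; for negative [q] the angle is
   reflected to [2 pi - acos], which stays in the range required by [integral_expR_cos_shift]. *)
have [q0|q0] := leP 0 q.
  exists (acos (p / r)); first by rewrite a0/=; lra.
  by rewrite acosK// sin_acos// sE ger0_norm// ![r * _]mulrC !divfK.
exists (2 * pi - acos (p / r)); first by apply/andP; split; lra.
have -> : 2 * pi - acos (p / r) = - acos (p / r) + pi *+ 2 by rewrite mulr_natl addrC.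
rewrite cosD2pi sinD2pi cosN sinN acosK// sin_acos// sE ltr0_norm//.
by rewrite mulNr opprK ![r * _]mulrC !divfK.
Qed.

(** In polar form the exponent is [2 |b| cos (t - phi)]. *)
Lemma integral_expR_phase (b : R[i]) :
  (\int[mu]_(t in `[(- pi)%R, pi])
     (expR (2 * (cos t * complex.Re b + sin t * complex.Im b)))%:E =
   (2 * pi * bessel_I0 (2 * normc b))%:E)%E.
Proof.
case: b => p q; have [phi phiI [pE qE]] := polar_angle p q.
set r := normc _ in pE qE *.
transitivity (\int[mu]_(t in `[(- pi)%R, pi]) (expR (2 * r * cos (t - phi)))%:E)%E.
  apply: eq_integral => t _; congr (expR _)%:E.
  by rewrite cosB /= {1}pE {1}qE; ring.
rewrite integral_expR_cos_shift// integral_expR_cos_even.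
(* Finiteness of the integral ensures that the real-valued integral in [bessel_I0] is its true
   value. *)
have ci : mu.-integrable `[0%R, pi] (fun t => (expR (2 * r * cos t))%:E).
  apply: continuous_compact_integrable; first exact: segment_compact.
  apply: continuous_subspaceT => x.
  apply: continuous_comp; last exact: continuous_expR.
  by apply: cvgM; [exact: cvg_cst|exact: continuous_cos].
have := integrable_fin_num _ ci => /(_ _)/fineK <-//.
rewrite -EFinM /bessel_I0 /Rintegral; congr EFin.
by rewrite mulrA mulfK// gt_eqF ?pi_gt0.
Qed.

Lemma bessel_I0_ge0 (z : R) : 0 <= bessel_I0 z.
Proof.
rewrite mulr_ge0 ?invr_ge0 ?pi_ge0//; apply: Rintegral_ge0 => x _.
exact: expR_ge0.
Qed.

End phase_integral.

(** * The law of the output *)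

Section channel.
Variables (R : realType) (T : nat) (rho : R) (s : 'cV[R[i]]_T).
Hypothesis rho_gt0 : 0 < rho.
Local Notation C := R[i].
Let D : 'M[C]_T := diag_mx s^T.
Let rC : C := (Num.sqrt rho)%:C.

(** Defined on matrices with any number of columns, so that the same map acts on [h], on its mean
    and on the factor [A]. *)
Definition channel n (t : R) (x : 'M[C]_(T, n)) : 'M[C]_(T, n) :=
  rC *: (D *m (expj t *: x)).

Lemma channelE n t (x : 'M[C]_(T, n)) :
  channel t x = expj t *: (rC *: (D *m x)).
Proof. by rewrite /channel -scalemxAr !scalerA mulrC. Qed.

Lemma channel_affine n t (m : 'cV[C]_T) (A : 'M[C]_(T, n)) (z : 'cV[C]_n) :
  channel t (m + A *m z) = channel t m + channel t A *m z.
Proof. by rewrite !channelE mulmxDr !scalerDr -!scalemxAl mulmxA. Qed.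

Lemma measurable_channel d (X : measurableType d) n (f : X -> R)
    (g : X -> 'M[C]_(T, n)) :
  measurable_fun setT f -> measurable_fun setT g ->
  measurable_fun setT (fun x => channel (f x) (g x)).
Proof.
move=> mf mg; apply: measurable_fun_scalemx => //.
apply: measurable_fun_mulmx => //; apply: measurable_fun_scalemx => //.
apply: measurable_fun_complex => /=.
  apply: measurableT_comp mf.
  by apply: continuous_measurable_fun; exact: continuous_cos.
apply: measurableT_comp mf.
by apply: continuous_measurable_fun; exact: continuous_sin.
Qed.

Lemma expj_conj (t : R) : expj t * (expj t)^*%R = 1.
Proof.
rewrite /expj; apply/eqP; rewrite eq_complex /=; apply/andP; split; apply/eqP.
  by rewrite mulrN opprK -!expr2 cos2Dsin2.
by ring.
Qed.

Lemma sqrt_rho_conj : rC * rC^*%R = rho%:C.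
Proof.
rewrite /rC; apply/eqP; rewrite eq_complex /=; apply/andP; split; apply/eqP.
  by rewrite oppr0 mulr0 subr0 -expr2 sqr_sqrtr ?ltW.
by rewrite oppr0 mulr0 mul0r addr0.
Qed.

(** The scalars [e^(j t)] and [sqrt rho] meet their conjugates, which leaves [rho] and removes the
    phase. *)
Lemma cov_output_gram k (Lambda_h : 'M[R]_T) (A : 'M[C]_(T, k)) t :
  A *m A^t* = map_mx (real_complex R) Lambda_h ->
  cov_output rho s Lambda_h = 1%:M + channel t A *m (channel t A)^t*.
Proof.
move=> AE; rewrite /cov_output -AE addrC; congr (_ + _).
rewrite channelE !ctmxZ ctmxM -!scalemxAl -!scalemxAr !scalerA.
congr (_ *: _); last by rewrite -/D !mulmxA.
rewrite -sqrt_rho_conj -[LHS]mul1r -(expj_conj t); ring.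
Qed.

End channel.

Lemma normc_conj (R : realType) (z : R[i]) :
  ComplexField.Normc.normc z^*%R = ComplexField.Normc.normc z.
Proof.
case: z => x y; change (ComplexField.Normc.normc (x -i* y) =
  ComplexField.Normc.normc (x +i* y)).
by rewrite /= sqrrN.
Qed.

Section output_density.
Variables (R : realType) (T : nat) (rho : R) (s mu_h : 'cV[R[i]]_T)
  (L : 'M[R[i]]_T).
Hypotheses (rho_gt0 : 0 < rho) (pL : hermitian_posdef L).
Local Notation C := R[i].
Local Notation mu := (@lebesgue_measure R).
Local Notation normc := ComplexField.Normc.normc.
Let D : 'M[C]_T := diag_mx s^T.

Definition output_pdf (v : 'cV[C]_T) : R :=
  (pi ^+ T * complex.Re (\det L))^-1
    * expR (- complex.Re ((v^t* *m invmx L *m v) 0 0)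
            - rho * complex.Re
                ((mu_h^t* *m D^t* *m invmx L *m D *m mu_h) 0 0))
    * bessel_I0 (2 * Num.sqrt rho
        * normc ((v^t* *m invmx L *m D *m mu_h) 0 0)).

Lemma output_pdf_ge0 v : 0 <= output_pdf v.
Proof.
rewrite mulr_ge0 ?bessel_I0_ge0// mulr_ge0 ?expR_ge0//.
rewrite invr_ge0 mulr_ge0 ?exprn_ge0 ?pi_ge0//.
exact/ltW/Re_det_gt0.
Qed.

Let phase_pdf : R -> R := uniform_pdf (- pi) pi.

Let b : 'cV[C]_T := (Num.sqrt rho)%:C *: (D *m mu_h).

(** In the form at [v - e^(j t) b] only the cross term depends on [t]; all the rest leaves the
    integral as the constant [c]. *)
Lemma integral_phase_output_pdf v :
  (\int[mu]_t (phase_pdf t * cgauss_pdf L (v - channel rho s t mu_h))%:E =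
   (output_pdf v)%:E)%E.
Proof.
have [hL _ _] := pL; have hK := hermitian_inv hL.
have pi0 : 0 < pi :> R := pi_gt0 R.
pose beta := (b^t* *m invmx L *m v) 0 0.
(* The expansion produces [b^dagger L^-1 v], the conjugate of the product in the Bessel argument up
   to [sqrt rho]; the moduli do not see the conjugation. *)
have betaE : normc beta = Num.sqrt rho * normc ((v^t* *m invmx L *m D *m mu_h) 0 0).
  have -> : beta = (Num.sqrt rho)%:C * ((v^t* *m invmx L *m D *m mu_h) 0 0)^*%R.
    rewrite /beta /b ctmx00 ctmxZ !ctmxM trmxCK hK -!scalemxAl mxE !mulmxA.
    by congr (_ * _); exact: conjc_real.
  rewrite ComplexField.Normc.normcM; congr (_ * _).
    by rewrite /= expr0n addr0 sqrtr_sqr ger0_norm ?sqrtr_ge0.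
  exact: normc_conj.
have bE : complex.Re ((b^t* *m invmx L *m b) 0 0) =
    rho * complex.Re ((mu_h^t* *m D^t* *m invmx L *m D *m mu_h) 0 0).
  have -> : (b^t* *m invmx L *m b) 0 0 =
      rho%:C * (mu_h^t* *m D^t* *m invmx L *m D *m mu_h) 0 0.
    rewrite /b ctmxZ ctmxM -scalemxAr -!scalemxAl !mulmxA 2!mxE mulrA.
    by congr (_ * _); rewrite -(sqrt_rho_conj rho_gt0).
  by case: (_ 0 0) => x y /=; rewrite mul0r subr0.
(* The leading [(2 pi)^-1] is the uniform density; it cancels the [2 pi] of
   [integral_expR_phase]. *)
pose c := (2 * pi)^-1 * ((pi ^+ T * complex.Re (\det L))^-1 *
  expR (- complex.Re ((v^t* *m invmx L *m v) 0 0)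
            - rho * complex.Re
                ((mu_h^t* *m D^t* *m invmx L *m D *m mu_h) 0 0))).
have c0 : 0 <= c.
  rewrite mulr_ge0 ?invr_ge0 ?mulr_ge0 ?expR_ge0// ?invr_ge0 ?ltW//.
  by rewrite mulr_gt0 ?Re_det_gt0// exprn_gt0.
transitivity (\int[mu]_(t in `[(- pi)%R, pi]) (c%:E *
    (expR (2 * (cos t * complex.Re beta + sin t * complex.Im beta)))%:E))%E.
  rewrite [RHS]integral_mkcond; apply: eq_integral => t _.
  rewrite patchE mem_setE in_itv/= /phase_pdf /uniform_pdf.
  case: ifP => _; last by rewrite mul0r.
  rewrite -EFinM; congr EFin; rewrite opprK -mulr2n -[pi *+ 2]mulr_natl /c -!mulrA.
  congr (_ * _); rewrite channelE -/D -/b /cgauss_pdf Re_hermitian_form_sub//.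
  rewrite -/beta bE /expj sqr_normcE cos2Dsin2 mul1r; congr (_ * _).
  by rewrite -expRD; congr expR; rewrite /=; ring.
have mc : measurable_fun setT (fun t : R =>
    (expR (2 * (cos t * complex.Re beta + sin t * complex.Im beta)))%:E).
  apply/measurable_EFinP; apply: measurableT_comp => //; apply: measurable_funM => //.
  by apply: measurable_funD; apply: measurable_funM => //;
    apply: continuous_measurable_fun; [exact: continuous_cos|exact: continuous_sin].
rewrite ge0_integralZl//; last exact: (measurable_funTS mc).
rewrite integral_expR_phase betaE -EFinM /output_pdf; congr EFin.
rewrite [2 * (_ * normc _)]mulrA /c.
by rewrite mulrACA mulVf ?mul1r// gt_eqF// mulr_gt0.
Qed.

Lemma measurable_shifted_cgauss_pdf :
  measurable_fun setT (fun p : R * 'cV[C]_T =>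
    (phase_pdf p.1 * cgauss_pdf L (p.2 - channel rho s p.1 mu_h))%:E).
Proof.
apply/measurable_EFinP; apply: measurable_funM.
  by apply: measurableT_comp measurable_fst; exact: measurable_uniform_pdf.
apply: measurableT_comp (measurable_cgauss_pdf _) _.
apply: measurable_fun_addmx => //; apply: measurable_fun_oppmx.
exact: measurable_channel.
Qed.

(** As a marginal of a jointly measurable function the density is measurable by Tonelli, so no
    regularity of [bessel_I0] has to be established. *)
Lemma measurable_output_pdf : measurable_fun setT output_pdf.
Proof.
apply/measurable_EFinP.
rewrite (_ : EFin \o output_pdf = fubini_G mu (fun p : R * 'cV[C]_T =>
    (phase_pdf p.1 * cgauss_pdf L (p.2 - channel rho s p.1 mu_h))%:E)).
  apply: measurable_fun_fubini_tonelli_G; first exact: measurable_shifted_cgauss_pdf.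
  by move=> p; rewrite lee_fin mulr_ge0 ?uniform_pdf_ge0 ?cgauss_pdf_ge0// gtrN ?pi_gt0.
by apply/funext => v; rewrite /fubini_G /= integral_phase_output_pdf.
Qed.

End output_density.

(** * Assembling the law of the output by Tonelli *)

Section output_law.
Context (R : realType) (d : measure_display) (Omega : measurableType d)
  (P : probability Omega R) (T k : nat) (rho : R) (s mu_h : 'cV[R[i]]_T)
  (L : 'M[R[i]]_T) (A : 'M[R[i]]_(T, k))
  (h w : {RV P >-> 'cV[R[i]]_T}) (Theta : {RV P >-> R}).
Local Notation C := R[i].
Hypothesis pL : hermitian_posdef L.
Hypothesis rho_gt0 : 0 < rho.
Hypothesis LE : forall t,
  L = 1%:M + channel rho s t A *m (channel rho s t A)^t*.
Hypothesis hE : forall B : set 'cV[R[i]]_T, measurable B ->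
  P (h @^-1` B) = (\int[lebesgue_cV R k]_(z in [set z | B (mu_h + A *m z)%R])
                         (std_cgauss_pdf z)%:E)%E.
Hypothesis wE : has_density P w (@std_cgauss_pdf R T).
Hypothesis ThetaE : uniform_phase P Theta.
Hypothesis indep : mutually_independent3 P h w Theta.
Local Open Scope ereal_scope.

Variable B : set 'cV[C]_T.
Hypothesis mB : measurable B.

Let lT := lebesgue_cV R T.
Let lk := lebesgue_cV R k.
Let one_B v : \bar R := (\1_B v)%:E.

Let one_B_ge0 v : 0 <= one_B v. Proof. by rewrite lee_fin. Qed.

Let measurable_one_B : measurable_fun setT one_B.
Proof. by apply/measurable_EFinP; exact: measurable_indic. Qed.

Let integral_noise (c : 'cV[C]_T) :
  \int[distribution P w]_x one_B (c + x)%R =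
  \int[lT]_v (one_B v * (std_cgauss_pdf (v - c))%:E).
Proof.
have mc : measurable_fun setT (fun x : 'cV[C]_T => c + x)%R.
  exact: measurable_fun_addmx.
have [_ _ _ wE'] := wE.
rewrite (@ge0_integral_density _ _ _ _ _ lT (distribution P w) id
  (@std_cgauss_pdf R T) (@measurable_id _ _ _) (@measurable_std_cgauss_pdf R T)
  (@std_cgauss_pdf_ge0 R T) wE' (fun x => one_B (c + x)%R)); last 2 first.
- exact: measurableT_comp measurable_one_B mc.
- by move=> x; exact: one_B_ge0.
pose f v := one_B v * (std_cgauss_pdf (v - c))%:E.
rewrite -[RHS]/(\int[lT]_v f v) -(ge0_integral_lebesgue_cV_shift c (f := f)).
- by apply: eq_integral => x _; rewrite /f addrK addrC.
- apply: emeasurable_funM => //; apply/measurable_EFinP.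
  apply: measurableT_comp (@measurable_std_cgauss_pdf R T) _.
  exact: measurable_fun_addmx.
- by move=> v; rewrite mule_ge0// lee_fin std_cgauss_pdf_ge0.
Qed.

Let measurable_shifted_noise (X : measurableType (measure_tuple_display default_measure_display))
    (f : X -> 'cV[C]_T) : measurable_fun setT f ->
  measurable_fun setT (fun p : X * 'cV[C]_T =>
    one_B p.2 * (std_cgauss_pdf (p.2 - f p.1)%R)%:E).
Proof.
move=> mf; apply: emeasurable_funM.
  exact: measurableT_comp measurable_one_B measurable_snd.
apply/measurable_EFinP; apply: measurableT_comp (@measurable_std_cgauss_pdf R T) _.
apply: measurable_fun_addmx => //; apply: measurable_fun_oppmx.
exact: measurableT_comp mf measurable_fst.
Qed.

Let integral_noise_fading (t : R) :
  \int[distribution P h]_x \int[distribution P w]_z one_B (channel rho s t x + z)%R =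
  \int[lT]_v (one_B v * (cgauss_pdf L (v - channel rho s t mu_h))%:E).
Proof.
under eq_integral do rewrite integral_noise.
rewrite (@ge0_integral_density _ _ _ _ _ lk (distribution P h)
  (fun z => mu_h + A *m z)%R (@std_cgauss_pdf R k)); last 6 first.
- exact: measurable_affine_cV.
- exact: measurable_std_cgauss_pdf.
- exact: std_cgauss_pdf_ge0.
- exact: hE.
- apply: (@measurable_fun_fubini_tonelli_F _ _ _ _ _ lT (fun p : 'cV[C]_T * 'cV[C]_T =>
    one_B p.2 * (std_cgauss_pdf (p.2 - channel rho s t p.1)%R)%:E)).
    by apply: measurable_shifted_noise; exact: measurable_channel.
  by move=> p; rewrite mule_ge0// lee_fin std_cgauss_pdf_ge0.
- move=> x; apply: integral_ge0 => v _.
  by rewrite mule_ge0// lee_fin std_cgauss_pdf_ge0.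
pose G (p : 'cV[C]_k * 'cV[C]_T) := one_B p.2 *
  (std_cgauss_pdf (p.2 - channel rho s t (mu_h + A *m p.1))%R)%:E *
  (std_cgauss_pdf p.1)%:E.
have mG1 : measurable_fun setT (fun p : 'cV[C]_k * 'cV[C]_T => one_B p.2 *
    (std_cgauss_pdf (p.2 - channel rho s t (mu_h + A *m p.1))%R)%:E).
  apply: (@measurable_shifted_noise _ (fun z => channel rho s t (mu_h + A *m z)%R)).
  by apply: measurable_channel => //; exact: measurable_affine_cV.
have mG : measurable_fun setT G.
  apply: emeasurable_funM => //; apply/measurable_EFinP.
  exact: measurableT_comp (@measurable_std_cgauss_pdf R k) measurable_fst.
have G0 p : 0 <= G p.
  by rewrite /G !mule_ge0// lee_fin std_cgauss_pdf_ge0.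
transitivity (\int[lk]_z \int[lT]_v G (z, v)).
  apply: eq_integral => z _; rewrite -ge0_integralZr//.
  - exact: (measurableT_comp mG1 (pair1_measurable z)).
  - by move=> v _; rewrite mule_ge0// lee_fin std_cgauss_pdf_ge0.
  - by rewrite lee_fin std_cgauss_pdf_ge0.
rewrite fubini_tonelli//; apply: eq_integral => v _.
(* With [v] now outermost, the integral over [z] is a Gaussian one with base covariance [1] and
   factor [channel rho s t A]. *)
rewrite {1}(LE t) -integral_cgauss_pdf_gram; last exact: hermitian_posdef1.
rewrite -ge0_integralZl//.
- apply: eq_integral => z _; rewrite /G /= channel_affine -muleA; congr (_ * _).
  by rewrite cgauss_pdf1 -EFinM opprD addrA mulrC.
- apply/measurable_EFinP; apply: measurable_funM.
    exact: measurable_std_cgauss_pdf.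
  apply: measurableT_comp (measurable_cgauss_pdf _) _.
  apply: measurable_fun_addmx => //; apply: measurable_fun_oppmx.
  exact: measurable_fun_mulmx.
- move=> z _; rewrite lee_fin mulr_ge0 ?std_cgauss_pdf_ge0//.
  by apply: cgauss_pdf_ge0; exact: hermitian_posdef1.
Qed.

Lemma output_law_pdf :
  P [set omega | B (channel rho s (Theta omega) (h omega) + w omega)%R] =
  \int[lT]_(v in B) (output_pdf rho s mu_h L v)%:E.
Proof.
pose F (p : ('cV[C]_T * 'cV[C]_T) * R) := one_B (channel rho s p.2 p.1.1 + p.1.2)%R.
have mF : measurable_fun setT F.
  apply: measurableT_comp measurable_one_B _.
  apply: measurable_fun_addmx; first apply: measurable_channel => //.
    exact: measurableT_comp measurable_fst measurable_fst.
  exact: measurableT_comp measurable_snd measurable_fst.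
have mY : measurable_fun setT
    (fun omega => (channel rho s (Theta omega) (h omega) + w omega)%R).
  by apply: measurable_fun_addmx => //; exact: measurable_channel.
transitivity (\int[P]_omega F ((h omega, w omega), Theta omega)).
  set S := [set omega | _].
  have mS : measurable S by rewrite -[X in measurable X]setTI; exact: mY.
  transitivity (\int[P]_omega (\1_S omega)%:E); first by rewrite integral_indic// setIT.
  apply: eq_integral => omega _; rewrite /F /one_B /= !indicE.
  suff -> : (omega \in S) = (channel rho s (Theta omega) (h omega) + w omega \in B)%R by [].
  by apply/idP/idP; rewrite !inE.
rewrite (integral_independent3 indep mF); last by move=> p; exact: one_B_ge0.
rewrite /F /=.
under eq_integral do rewrite integral_noise_fading.
pose G (p : R * 'cV[C]_T) := one_B p.2 *
  (uniform_pdf (- pi) pi p.1 * cgauss_pdf L (p.2 - channel rho s p.1 mu_h))%:E.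
have u0 (t : R) : (0 <= uniform_pdf (- pi) pi t)%R.
  by rewrite uniform_pdf_ge0// gtrN ?pi_gt0.
have mG : measurable_fun setT G.
  apply: emeasurable_funM; first exact: measurableT_comp measurable_one_B measurable_snd.
  exact: measurable_shifted_cgauss_pdf.
have G0 p : 0 <= G p.
  by rewrite /G mule_ge0// lee_fin mulr_ge0// cgauss_pdf_ge0.
(* [H] is the integrand under the law of [Theta]; [G] includes the density of that law and is
   integrated against Lebesgue measure. *)
pose H (p : R * 'cV[C]_T) := one_B p.2 *
  (cgauss_pdf L (p.2 - channel rho s p.1 mu_h))%:E.
have mH : measurable_fun setT H.
  apply: emeasurable_funM; first exact: measurableT_comp measurable_one_B measurable_snd.
  apply/measurable_EFinP; apply: measurableT_comp (measurable_cgauss_pdf _) _.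
  apply: measurable_fun_addmx => //; apply: measurable_fun_oppmx.
  exact: measurable_channel.
have H0 p : 0 <= H p.
  by rewrite /H mule_ge0// lee_fin cgauss_pdf_ge0.
rewrite (@ge0_integral_density _ _ _ _ _ (@lebesgue_measure R) (distribution P Theta) id
  (uniform_pdf (- pi) pi)); last 6 first.
- exact: measurable_id.
- exact: measurable_uniform_pdf.
- exact: u0.
- by move=> E mE; rewrite -[LHS]/(P (Theta @^-1` E)) ThetaE.
- exact: (@measurable_fun_fubini_tonelli_F _ _ _ _ _ lT H mH H0).
- by move=> t; apply: integral_ge0 => v _; exact: (H0 (t, v)).
transitivity (\int[@lebesgue_measure R]_t \int[lT]_v G (t, v)).
  apply: eq_integral => t _.
  transitivity (\int[lT]_v (H (t, v) * (uniform_pdf (- pi) pi t)%:E)).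
    apply/esym; apply: (ge0_integralZr lT measurableT
      (measurableT_comp mH (pair1_measurable t))).
      by move=> v _; exact: (H0 (t, v)).
    by rewrite lee_fin.
  by apply: eq_integral => v _; rewrite /G /H /= EFinM -muleA [X in _ * X]muleC.
(* The exchange brings the phase inside, where at fixed [v] it averages to [output_pdf]. *)
rewrite fubini_tonelli// [RHS]integral_mkcond; apply: eq_integral => v _.
transitivity (one_B v * \int[@lebesgue_measure R]_t
    (uniform_pdf (- pi) pi t * cgauss_pdf L (v - channel rho s t mu_h))%:E).
  have K0 t : setT t -> 0 <= ((fun p : R * 'cV[C]_T => (uniform_pdf (- pi) pi p.1 *
      cgauss_pdf L (p.2 - channel rho s p.1 mu_h))%:E) \o pair^~ v) t.
    by move=> _; rewrite lee_fin mulr_ge0// cgauss_pdf_ge0.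
  exact: (@ge0_integralZl _ _ _ (@lebesgue_measure R) _ measurableT _
    (measurableT_comp (measurable_shifted_cgauss_pdf rho s mu_h L) (pair2_measurable v))
    (one_B v) K0 (one_B_ge0 v)).
rewrite integral_phase_output_pdf// patchE /one_B indicE.
by case: ifP => _; rewrite ?mul1e ?mul0e.
Qed.

End output_law.

Theorem mainTheorem1 (R : realType) (d : measure_display)
    (Omega : measurableType d) (P : probability Omega R)
    (T : nat) (rho : R) (s mu_h : 'cV[R[i]]_T) (Lambda_h : 'M[R]_T)
    (h w : {RV P >-> 'cV[R[i]]_T}) (Theta : {RV P >-> R})
    (y : Omega -> 'cV[R[i]]_T)
    (T_ge1 : (1 <= T)%N) (rho_gt0 : 0 < rho)
    (Lambda_h_psd : psd Lambda_h)
    (h_law : complex_normal P h mu_h (map_mx (real_complex R) Lambda_h))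
    (w_law : has_density P w (@std_cgauss_pdf R T))
    (Theta_law : uniform_phase P Theta)
    (indep : mutually_independent3 P h w Theta)
    (y_def : forall omega, y omega =
       (Num.sqrt rho)%:C *: (diag_mx s^T *m (expj (Theta omega) *: h omega))
       + w omega) :
  let D := diag_mx s^T in
  let Lambda := cov_output rho s Lambda_h in
  has_density P y (fun v =>
    (pi ^+ T * complex.Re (\det Lambda))^-1
    * expR (- complex.Re ((v^t* *m invmx Lambda *m v) 0 0)
            - rho * complex.Re
                ((mu_h^t* *m D^t* *m invmx Lambda *m D *m mu_h) 0 0))
    * bessel_I0 (2 * Num.sqrt rho
        * ComplexField.Normc.normc ((v^t* *m invmx Lambda *m D *m mu_h) 0 0))).
Proof.
move=> D Lambda.
have [[mh [k [m [A hE]]]] meanE covE] := h_law.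
have mE : m = mu_h.
  apply/matrixP => i j; rewrite ord1 -meanE.
  by rewrite (cexpectation_circular_gaussian mh hE).
subst m.
have AE : A *m A^t* = map_mx (real_complex R) Lambda_h.
  apply/matrixP => i j; rewrite -covE.
  by rewrite (cexpectation_circular_gaussian_cov mh hE).
have LE t := cov_output_gram s rho_gt0 t AE.
(* [Lambda] has the form [1 + N N^dagger], with [N] the image of [A] under the channel; the phase 0
   is an arbitrary choice. *)
have pL : hermitian_posdef Lambda.
  rewrite /Lambda (LE 0); apply: hermitian_posdef_gram.
  exact: hermitian_posdef1.
have yE : y = fun omega => channel rho s (Theta omega) (h omega) + w omega.
  by apply/funext => omega; rewrite y_def.
split.
- rewrite yE; apply: measurable_fun_addmx => //; exact: measurable_channel.
- exact: (measurable_output_pdf s mu_h rho_gt0 pL).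
- exact: (output_pdf_ge0 rho s mu_h pL).
- move=> B mB; rewrite yE.
  exact: (output_law_pdf pL rho_gt0 LE hE w_law Theta_law indep mB).
Qed.
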